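(* Consider the iterates of Algorithm S-PStorm (described in the context) applied to $\min_{x\in\mathbb{R}^n} f(x)+r(x)$, and suppose that assumptions (A), (B) and (C) of the context hold. Let $\epsilon_k=d_k-\nabla f(x_k)$ for all integers $k\ge 1$ and let $\underline{k}=\lceil 2c-1\rceil$. Then there is a constant $C>0$ independent of $k$ such that, for any $k\ge\underline{k}$ and any $\eta_k\in(0,1)$, the event $\mathcal{E}_k:=\{\|\epsilon_k\|\le U(k)\}$ holds with probability at least $1-\eta_k$, where $$U(k)=C\big(\sigma+L_g(G_r+G_d)\zeta\underline{\alpha}\big)\cdot\max\left\{\left(\frac{\underline{k}+1}{k+2}\right)^{c},\ \frac{c}{\sqrt{k+2}}\right\}\sqrt{\log\frac{2}{\eta_k}}.$$
   Context: $\|\cdot\|$ is the Euclidean norm. Problem: $\min_{x\in\mathbb{R}^n}F(x):=f(x)+r(x)$, where $f(x)=\mathbb{E}_{\xi\sim\mathcal{P}}[\ell(x;\xi)]$ for a random vector $\xi$ with distribution $\mathcal{P}$, $\ell(\cdot;\xi)$ is almost surely smooth (differentiable) and convex, and $r(x)=\sum_{i=1}^{n_{\mathcal G}}r_i([x]_{g_i})$ with $\{g_i\}_{i=1}^{n_{\mathcal G}}$ a partition of $\{1,\dots,n\}$ and $[x]_{g_i}$ the subvector of $x$ indexed by $g_i$. The proximal operator is $\mathrm{prox}_{\alpha r}(z)=\arg\min_{x}\{\frac{1}{2\alpha}\|x-z\|^2+r(x)\}$. Algorithm S-PStorm. Inputs: $x_0=x_1\in\mathbb{R}^n$, mini-batch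 size $m\in\mathbb{N}_+$, weights $\beta_k\in(0,1)$, stepsizes $\alpha_k>0$, parameter $\zeta\in(0,\infty)$. For $k=1,2,\dots$: draw $m$ i.i.d. samples $\xi_{k1},\dots,\xi_{km}$ from $\mathcal{P}$ (independent of all earlier samples); set $v_k=\frac1m\sum_{i=1}^m\nabla\ell(x_k;\xi_{ki})$; if $k=1$ set $d_1=v_1$, otherwise set $u_k=\frac1m\sum_{i=1}^m\nabla\ell(x_{k-1};\xi_{ki})$ and $d_k=v_k+(1-\beta_k)(d_{k-1}-u_k)$; set $y_k=\mathrm{prox}_{\alpha_k r}(x_k-\alpha_k d_k)$; set $x_{k+1}=x_k+\zeta\beta_k(y_k-x_k)$. Filtration: $\mathcal{F}_1=\sigma(x_1)$ and, for $k\ge2$, $\mathcal{F}_k$ is the $\sigma$-algebra generated by the samples of iterations $1,\dots,k-1$. Assumption (A): (1) $f$ is $\mu_f$-strongly convex on $\mathbb{R}^n$ ($\mu_f>0$) and every $r_i$ is a real-valued closed convex function. (2) There is $L_g>0$ such that $\|\nabla\ell(x;\xi)-\nabla\ell(y;\xi)\|\le L_g\|x-y\|$ for all $x,y\in\mathbb{R}^n$ and every $\xi\sim\mathcal{P}$; in particular $\nabla f$ is $L_g$-Lipschitz. Assumption (B): for all $k\ge1$ (with $\xi\sim\mathcal{P}$ independent of $\mathcal{F}_k$): (1) $\mathbb{E}_{\xi\sim\mathcal{P}}[\nabla\ell(x_k;\xi)\mid\mathcal{F}_k]=\nabla f(x_k)$; (2) there is $G_r>0$, independent of $k$, with $\mathbb{P}\{\|g\|\le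 G_r\ \forall g\in\partial r(x_k)\}=1$; (3) there is $\sigma>0$, independent of $k$, with $\mathbb{P}_{\xi\sim\mathcal{P}}\{\|\nabla\ell(x_k;\xi)-\nabla f(x_k)\|\le\sigma\mid\mathcal{F}_k\}=1$; (4) there is $G_d>0$, independent of $k$, with $\mathbb{P}\{\|d_k\|\le G_d\mid\mathcal{F}_k\}=1$. Assumption (C): for constants $c>1$ and $\underline{\alpha}\in(0,\infty)$, $\beta_k=\min\{1/2,\,c/(k+1)\}$ and $\alpha_k=\underline{\alpha}$ for all $k\ge1$. *)

(* Defs.v *)
From HB Require Import structures.
From mathcomp Require Import all_boot all_order all_algebra.
From mathcomp Require Import all_classical all_reals all_analysis.

Set Implicit Arguments.
Unset Strict Implicit.
Unset Printing Implicit Defensive.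

Import Order.TTheory GRing.Theory Num.Theory.
Import numFieldNormedType.Exports.

Local Open Scope classical_set_scope.
Local Open Scope ring_scope.

Definition dotp (R : realType) (n : nat) (u v : 'rV[R]_n) : R :=
  \sum_(i < n) u 0 i * v 0 i.

(* The library norm `|u| on row vectors is the sup norm, hence a separate
   Euclidean norm. *)
Definition enorm (R : realType) (n : nat) (u : 'rV[R]_n) : R :=
  Num.sqrt (dotp u u).

Definition gradient (R : realType) (n : nat) (h : 'rV[R]_n -> R^o)
    (x : 'rV[R]_n) : 'rV[R]_n :=
  \row_(i < n) 'D_(delta_mx 0 i) h x.

Definition strongly_convex (R : realType) (n : nat) (mu : R)
    (h : 'rV[R]_n -> R) : Prop :=
  forall (x y : 'rV[R]_n) (t : R), 0 <= t <= 1 ->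
    h (t *: x + (1 - t) *: y) <=
    t * h x + (1 - t) * h y - mu / 2 * t * (1 - t) * enorm (x - y) ^+ 2.

Definition closed_function (R : realType) (n : nat) (h : 'rV[R]_n -> R) : Prop :=
  closed [set p : 'rV[R]_n * R^o | h p.1 <= p.2].

Definition subdifferential (R : realType) (n : nat) (h : 'rV[R]_n -> R)
    (x : 'rV[R]_n) : set 'rV[R]_n :=
  [set g | forall y, h x + dotp g (y - x) <= h y].

Definition argmin (R : realType) (n : nat) (h : 'rV[R]_n -> R) :
    set 'rV[R]_n :=
  [set x | forall y, h x <= h y].

(* xget picks the element of the argmin set; its default value 0 is used only
   when that set is empty, which does not happen for real-valued convex r and
   positive a. *)
Definition prox (R : realType) (n : nat) (a : R) (r : 'rV[R]_n -> R)
    (z : 'rV[R]_n) : 'rV[R]_n :=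
  xget 0 (argmin (fun x => (2 * a)^-1 * enorm (x - z) ^+ 2 + r x)).

Definition subvector (R : realType) (n : nat) (A : {set 'I_n})
    (x : 'rV[R]_n) : 'rV[R]_#|A| :=
  \row_(j < #|A|) x 0 (enum_val j).

Definition is_indexed_partition (n N : nat) (g : 'I_N -> {set 'I_n}) : Prop :=
  injective g /\
  finset.partition [set g i | i : 'I_N]%SET [set: 'I_n]%SET.

Definition group_sum (R : realType) (n N : nat) (g : 'I_N -> {set 'I_n})
    (r_ : forall i : 'I_N, 'rV[R]_#|g i| -> R) (x : 'rV[R]_n) : R :=
  \sum_(i < N) r_ i (subvector (g i) x).

Definition expected_loss (R : realType) (n : nat) (dX : measure_display)
    (Xi : measurableType dX) (P : probability Xi R)
    (l : 'rV[R]_n -> Xi -> R) (x : 'rV[R]_n) : R :=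
  fine ('E_P[l x])%E.

Section Probability.
Context (R : realType) (dO dX : measure_display) (Omega : measurableType dO)
  (Xi : measurableType dX) (Pr : probability Omega R) (P : probability Xi R).

Definition has_law (X : {RV Pr >-> Xi}) : Prop :=
  forall A : set Xi, measurable A -> distribution Pr X A = P A.

Definition mutually_independent (I : eqType) (D : set I)
    (X : I -> {RV Pr >-> Xi}) : Prop :=
  forall (s : seq I) (A : I -> set Xi),
    uniq s -> (forall i, i \in s -> D i) -> (forall i, measurable (A i)) ->
    Pr (\bigcap_(i in [set` s]) (X i @^-1` A i)) =
    (\prod_(i <- s) Pr (X i @^-1` A i))%E.

Definition independent_of (X : {RV Pr >-> Xi}) (G : set (set Omega)) : Prop :=
  forall (A : set Xi) (B : set Omega), measurable A -> G B ->
    Pr ((X @^-1` A) `&` B) = (Pr (X @^-1` A) * Pr B)%E.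

(* Y is a version of the conditional expectation E[X | G]. *)
Definition is_cond_expectation (G : set (set Omega)) (X Y : Omega -> R) : Prop :=
  [/\ Pr.-integrable setT (EFin \o X),
      Pr.-integrable setT (EFin \o Y),
      (forall B : set R, measurable B -> G (Y @^-1` B)) &
      forall A : set Omega, G A ->
        (\int[Pr]_(w in A) (X w)%:E = \int[Pr]_(w in A) (Y w)%:E)%E].

Definition is_cond_probability (G : set (set Omega)) (A : set Omega)
    (Y : Omega -> R) : Prop :=
  is_cond_expectation G (\1_A) Y.

(* The sample indices start at k = 1; the values xi 0 are never used. *)
Definition iid_samples (m : nat) (xi : nat -> 'I_m -> {RV Pr >-> Xi}) : Prop :=
  (forall k i, (1 <= k)%N -> has_law (xi k i)) /\
  mutually_independent [set p : nat * 'I_m | (1 <= p.1)%N]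
    (fun p => xi p.1 p.2).

(* The sigma-algebra generated by the samples of iterations 1, ..., k - 1.
   There is no generator for k = 1, which gives the trivial sigma-algebra,
   that is, the one generated by the deterministic starting point x_1. *)
Definition filtration (m : nat) (xi : nat -> 'I_m -> {RV Pr >-> Xi})
    (k : nat) : set (set Omega) :=
  <<s [set B | exists (t : nat) (i : 'I_m) (A : set Xi),
         [/\ (1 <= t < k)%N, measurable A & B = xi t i @^-1` A]] >>.

Section Algorithm.
Context (n : nat) (l : 'rV[R]_n -> Xi -> R).

Let f : 'rV[R]_n -> R := expected_loss P l.
Let grad_l (x : 'rV[R]_n) (z : Xi) : 'rV[R]_n := gradient (l ^~ z) x.

Record S_PStorm (m : nat) (xi : nat -> 'I_m -> {RV Pr >-> Xi})
    (r : 'rV[R]_n -> R) (x1 : 'rV[R]_n) (beta alpha : nat -> R) (zeta : R)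
    (x v u d y : nat -> Omega -> 'rV[R]_n) : Prop := {
  storm_batch : (0 < m)%N ;
  storm_beta : forall k, (1 <= k)%N -> 0 < beta k < 1 ;
  storm_alpha : forall k, (1 <= k)%N -> 0 < alpha k ;
  storm_zeta : 0 < zeta ;
  storm_samples : iid_samples xi ;
  storm_x0 : forall w, x 0%N w = x1 ;
  storm_x1 : forall w, x 1%N w = x1 ;
  storm_v : forall k w, (1 <= k)%N ->
    v k w = m%:R^-1 *: \sum_(i < m) grad_l (x k w) (xi k i w) ;
  storm_d1 : forall w, d 1%N w = v 1%N w ;
  storm_u : forall k w, (2 <= k)%N ->
    u k w = m%:R^-1 *: \sum_(i < m) grad_l (x k.-1 w) (xi k i w) ;
  storm_d : forall k w, (2 <= k)%N ->
    d k w = v k w + (1 - beta k) *: (d k.-1 w - u k w) ;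
  storm_y : forall k w, (1 <= k)%N ->
    y k w = prox (alpha k) r (x k w - alpha k *: d k w) ;
  storm_x : forall k w, (1 <= k)%N ->
    x k.+1 w = x k w + (zeta * beta k) *: (y k w - x k w)
}.

(* Standing requirements on the loss: f is a well-defined real-valued
   expectation, and the loss is almost surely differentiable and convex. *)
Record smooth_convex_loss : Prop := {
  loss_integrable : forall x, P.-integrable setT (EFin \o l x) ;
  loss_smooth_convex : {ae P, forall z,
    (forall x : 'rV[R]_n, differentiable (l ^~ z : 'rV[R]_n -> R^o) x) /\
    convex_function setT (l ^~ z)}
}.

Record assumption_A (N : nat) (g : 'I_N -> {set 'I_n})
    (r_ : forall i : 'I_N, 'rV[R]_#|g i| -> R) (mu_f Lg : R) : Prop := {
  A_mu_gt0 : 0 < mu_f ;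
  A_strongly_convex : strongly_convex mu_f f ;
  A_r_convex : forall i, convex_function setT (r_ i) ;
  A_r_closed : forall i, closed_function (r_ i) ;
  A_Lg_gt0 : 0 < Lg ;
  A_lipschitz : {ae P, forall z, forall x y : 'rV[R]_n,
    enorm (grad_l x z - grad_l y z) <= Lg * enorm (x - y)}
}.

(* In B_unbiased and B_variance, xi' is a generic sample drawn from P
   independently of the past. *)
Record assumption_B (m : nat) (xi : nat -> 'I_m -> {RV Pr >-> Xi})
    (r : 'rV[R]_n -> R) (x d : nat -> Omega -> 'rV[R]_n)
    (Gr sigma Gd : R) : Prop := {
  B_unbiased : forall (k : nat) (xi' : {RV Pr >-> Xi}), (1 <= k)%N ->
    has_law xi' -> independent_of xi' (filtration xi k) ->
    forall j : 'I_n, is_cond_expectation (filtration xi k)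
      (fun w => grad_l (x k w) (xi' w) 0 j)
      (fun w => gradient f (x k w) 0 j) ;
  B_Gr_gt0 : 0 < Gr ;
  B_subgradients : forall k, (1 <= k)%N ->
    {ae Pr, forall w, forall s, subdifferential r (x k w) s -> enorm s <= Gr} ;
  B_sigma_gt0 : 0 < sigma ;
  B_variance : forall (k : nat) (xi' : {RV Pr >-> Xi}), (1 <= k)%N ->
    has_law xi' -> independent_of xi' (filtration xi k) ->
    is_cond_probability (filtration xi k)
      [set w | enorm (grad_l (x k w) (xi' w) - gradient f (x k w)) <= sigma]
      (cst 1) ;
  B_Gd_gt0 : 0 < Gd ;
  B_direction : forall k, (1 <= k)%N ->
    is_cond_probability (filtration xi k) [set w | enorm (d k w) <= Gd] (cst 1)
}.

End Algorithm.

Record assumption_C (c alpha_ : R) (beta alpha : nat -> R) : Prop := {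
  C_c_gt1 : 1 < c ;
  C_alpha_gt0 : 0 < alpha_ ;
  C_beta : forall k, (1 <= k)%N -> beta k = Num.min (1 / 2) (c / k.+1%:R) ;
  C_alpha : forall k, (1 <= k)%N -> alpha k = alpha_
}.

End Probability.

(* Main.v *)
(* The error obeys eps_k = (1 - beta_k) eps_(k-1) + psi_k, where psi_k has zero
   mean given F_k and is almost surely at most B beta_k in norm: the gradient
   noise contributes beta_k sigma, and by Lipschitz continuity the remainder is
   controlled by |x_k - x_(k-1)|, itself O(beta_(k-1)) because the proximal step
   moves x by at most alpha (Gd + Gr).  Since exp t <= t + exp (2 t^2), an
   Azuma-type induction bounds the moment generating function of each coordinate
   of eps_k by exp (lam^2 V_k) with
   V_k = (1 - beta_k)^2 V_(k-1) + 2 (B beta_k)^2, and c > 1 makes V_k <= K/(k+2)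
   self-reproducing.  Chernoff's bound and a union bound over the coordinates
   conclude; the constant C absorbs the dimension, and only the second term of
   the maximum is needed.
   The conditional mean of psi_k given F_k involves the loss gradient at x_(k-1)
   for a sample of iteration k, which the unbiasedness hypothesis only covers
   given F_(k-1).  It is therefore recomputed by Fubini's theorem from the
   independence of the samples and from grad f = E[grad l(., xi)]. *)
Require Import Defs.
From HB Require Import structures.
From mathcomp Require Import all_boot all_order all_algebra ring lra.
From mathcomp Require Import all_classical all_reals all_analysis.
From mathcomp Require Import measurable_realfun.

Set Implicit Arguments.
Unset Strict Implicit.
Unset Printing Implicit Defensive.

Import Order.TTheory GRing.Theory Num.Theory.
Import numFieldNormedType.Exports.

Local Open Scope classical_set_scope.
Local Open Scope ring_scope.

(** * Euclidean geometry and subgradients *)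

Section Euclidean.
Context (R : realType) (n : nat).
Implicit Types (u v w x y z s : 'rV[R]_n) (a b t : R).

Lemma dotpC u v : dotp u v = dotp v u.
Proof. by apply: eq_bigr => i _; rewrite mulrC. Qed.

Lemma dotpDl u v w : dotp (u + v) w = dotp u w + dotp v w.
Proof. by rewrite -big_split; apply: eq_bigr => i _; rewrite mxE mulrDl. Qed.

Lemma dotpZl a u v : dotp (a *: u) v = a * dotp u v.
Proof. by rewrite mulr_sumr; apply: eq_bigr => i _; rewrite mxE mulrA. Qed.

Lemma dotpNl u v : dotp (- u) v = - dotp u v.
Proof. by rewrite -scaleN1r dotpZl mulN1r. Qed.

Lemma dotpDr u v w : dotp w (u + v) = dotp w u + dotp w v.
Proof. by rewrite dotpC dotpDl !(dotpC w). Qed.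

Lemma dotpZr a u v : dotp u (a *: v) = a * dotp u v.
Proof. by rewrite dotpC dotpZl dotpC. Qed.

Lemma dotpNr u v : dotp u (- v) = - dotp u v.
Proof. by rewrite dotpC dotpNl dotpC. Qed.

Definition dotpE := (dotpDl, dotpDr, dotpZl, dotpZr, dotpNl, dotpNr).

Lemma dotp_ge0 u : 0 <= dotp u u.
Proof. by apply: sumr_ge0 => i _; rewrite -expr2 sqr_ge0. Qed.

Lemma enorm_ge0 u : 0 <= enorm u. Proof. exact: sqrtr_ge0. Qed.

Lemma sqr_enorm u : enorm u ^+ 2 = dotp u u.
Proof. by rewrite sqr_sqrtr ?dotp_ge0. Qed.

Lemma enorm0 : enorm (0 : 'rV[R]_n) = 0.
Proof. by rewrite /enorm -(scale0r (0 : 'rV[R]_n)) dotpZl mul0r sqrtr0. Qed.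

Lemma enormZ a u : enorm (a *: u) = `|a| * enorm u.
Proof.
by rewrite /enorm !dotpE mulrA -expr2 sqrtrM ?sqr_ge0// sqrtr_sqr.
Qed.

Lemma enormN u : enorm (- u) = enorm u.
Proof. by rewrite -scaleN1r enormZ normrN1 mul1r. Qed.

Lemma enormB u v : enorm (u - v) = enorm (v - u).
Proof. by rewrite -enormN opprB. Qed.

(** Cauchy-Schwarz: the squared norm of [dotp v v *: u - dotp u v *: v] is nonnegative, and a
    positive factor [dotp v v] can be cancelled from it. *)
Lemma dotp_le_enorm u v : dotp u v <= enorm u * enorm v.
Proof.
have [v0|v0] := eqVneq (dotp v v) 0.
  have v0i i : v 0 i = 0.
    move: v0 => /eqP; rewrite psumr_eq0 => [/allP/(_ i)|j _]; last first.
      by rewrite -expr2 sqr_ge0.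
    by rewrite mem_index_enum mulf_eq0 orbb => /(_ isT)/eqP.
  rewrite /dotp big1 => [|i _]; first by rewrite mulr_ge0 ?enorm_ge0.
  by rewrite v0i mulr0.
have v_gt0 : 0 < dotp v v by rewrite lt_neqAle eq_sym v0 dotp_ge0.
have := dotp_ge0 (dotp v v *: u - dotp u v *: v).
have -> : dotp (dotp v v *: u - dotp u v *: v) (dotp v v *: u - dotp u v *: v) =
    dotp v v * (dotp v v * dotp u u - dotp u v ^+ 2).
  by rewrite !dotpE (dotpC v u); ring.
rewrite pmulr_rge0// subr_ge0 => le2.
rewrite (le_trans (ler_norm _))// -sqrtr_sqr /enorm -sqrtrM ?dotp_ge0//.
by rewrite ler_wsqrtr// mulrC.
Qed.

Lemma ler_enormD u v : enorm (u + v) <= enorm u + enorm v.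
Proof.
rewrite -(@ler_pXn2r _ 2) ?nnegrE ?addr_ge0 ?enorm_ge0//.
rewrite sqr_enorm sqrrD !sqr_enorm !dotpE (dotpC v u).
have := dotp_le_enorm u v; lra.
Qed.

Lemma norm_coord_le u i : `|u 0 i| <= enorm u.
Proof.
rewrite -sqrtr_sqr /enorm ler_wsqrtr// /dotp (bigD1 i)//= expr2 lerDl.
by apply: sumr_ge0 => j _; rewrite -expr2 sqr_ge0.
Qed.

(** A crude constant: [n.+1] in place of the square root of [n] stays positive for [n = 0] and can
    be divided by. *)
Lemma enorm_le_coord u b : 0 <= b -> (forall i, `|u 0 i| <= b) ->
  enorm u <= n.+1%:R * b.
Proof.
move=> b0 ub; rewrite -(@ler_pXn2r _ 2) ?nnegrE ?mulr_ge0 ?enorm_ge0//.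
rewrite sqr_enorm (@le_trans _ _ (\sum_(i < n) b ^+ 2))//.
  apply: ler_sum => i _; rewrite -expr2 -(real_normK (num_real _)).
  by rewrite ler_pXn2r ?nnegrE.
rewrite sumr_const card_ord exprMn -[_ *+ n]mulr_natl ler_wpM2r ?sqr_ge0//.
by rewrite -natrX ler_nat -mulnn mulnS ltnW// ltnS leq_addr.
Qed.

Definition convex_fun (h : 'rV[R]_n -> R) := forall x y t, 0 <= t <= 1 ->
  h (t *: x + (1 - t) *: y) <= t * h x + (1 - t) * h y.

(** Minorisation of [h] by the linear form [s] on the span of the first [k] coordinate vectors. *)
Let agree_below (h : 'rV[R]_n -> R) k s :=
  forall v, (forall i : 'I_n, (k <= i)%N -> v 0 i = 0) -> dotp s v <= h v.

(* One Hahn-Banach step: the two families of bounds on the new coordinate of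
   the linear form are separated by convexity. *)
Lemma extend_minorant (h : 'rV[R]_n -> R) (k : 'I_n) s :
  convex_fun h -> agree_below h k s -> exists s', agree_below h k.+1 s'.
Proof.
move=> ch hs; pose e : 'rV[R]_n := delta_mx 0 k.
pose V v := forall i : 'I_n, (k <= i)%N -> v 0 i = 0.
have sep v v' a b : V v -> V v' -> 0 < a -> 0 < b ->
    (dotp s v' - h (v' - a *: e)) / a <= (h (v + b *: e) - dotp s v) / b.
  move=> Vv Vv' a0 b0; have ab0 : 0 < a + b by lra.
  (* With weight [a / (a + b)] the components along [e] cancel, so the convex combination lies in
     the subspace where [s] is already a minorant. *)
  have t01 : 0 <= a / (a + b) <= 1.
    by rewrite divr_ge0 ?(ltW a0) ?(ltW ab0)//= ler_pdivrMr//; lra.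
  have := ch (v + b *: e) (v' - a *: e) _ t01.
  have -> : 1 - a / (a + b) = b / (a + b) by field; lra.
  set p := (X in h X <= _) => hp.
  have pE : p = a / (a + b) *: v + b / (a + b) *: v'.
    rewrite /p; apply/rowP => i; rewrite !mxE.
    by field; lra.
  have : dotp s p <= h p.
    by apply: hs => i ki; rewrite pE !mxE Vv// Vv'// !mulr0 addr0.
  move=> /le_trans/(_ hp); rewrite pE !dotpE.
  have E p1 q : a / (a + b) * p1 + b / (a + b) * q = (a * p1 + b * q) / (a + b).
    by field; lra.
  rewrite !E ler_pM2r ?invr_gt0// => H.
  by rewrite ler_pdivrMr// mulrAC ler_pdivlMr//; lra.
have V0 : V 0 by move=> i _; rewrite mxE.
pose L : set R := [set p | exists v a, [/\ V v, 0 < a &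
  p = (dotp s v - h (v - a *: e)) / a]].
have L0 : L !=set0.
  by exists ((dotp s 0 - h (0 - 1 *: e)) / 1), 0, 1; split.
have Lub q : (exists v b, [/\ V v, 0 < b & q = (h (v + b *: e) - dotp s v) / b])
    -> ubound L q.
  by move=> [v [b [Vv b0 ->]]] _ [v' [a [Vv' a0 ->]]]; exact: sep.
have hL : has_sup L.
  split=> //; exists ((h (0 + 1 *: e) - dotp s 0) / 1).
  by apply: Lub; exists 0, 1; split.
(* The new coordinate is [sup L]. A negative [v 0 k] uses that it bounds [L] from above, a positive
   one that it is the least such bound. *)
exists (s + (sup L - s 0 k) *: e) => v Vv.
pose v0 := v - v 0 k *: e.
have Vv0 : V v0.
  move=> i; rewrite leq_eqVlt !mxE eqxx /= => /orP[/eqP/val_inj<-|ki].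
    by rewrite eqxx mulr1 subrr.
  by rewrite Vv// -val_eqE/= gtn_eqF// mulr0 subr0.
have vE : v = v0 + v 0 k *: e by rewrite subrK.
have dote w : dotp w e = w 0 k.
  rewrite /dotp (bigD1 k)//= big1 ?addr0 ?mxE ?eqxx ?mulr1// => i ik.
  by rewrite mxE eqxx (negbTE ik) mulr0.
have -> : dotp (s + (sup L - s 0 k) *: e) v = dotp s v0 + v 0 k * sup L.
  by rewrite {1}vE !dotpE !(dotpC e) !dote !mxE !eqxx /=; ring.
have [vk0|vk0|vk0] := ltgtP (v 0 k) 0.
- have : L ((dotp s v0 - h (v0 - (- v 0 k) *: e)) / (- v 0 k)).
    by exists v0, (- v 0 k); split; rewrite ?oppr_gt0.
  move=> /(ub_le_sup hL.2); rewrite ler_pdivrMr ?oppr_gt0//.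
  by rewrite scaleNr opprK -vE; lra.
- have : sup L <= (h (v0 + v 0 k *: e) - dotp s v0) / (v 0 k).
    by apply: ge_sup => //; apply: Lub; exists v0, (v 0 k).
  by rewrite ler_pdivlMr// -vE; lra.
- have v0E : v0 = v by rewrite /v0 vk0 scale0r subr0.
  by rewrite vk0 mul0r addr0; have := hs _ Vv0; rewrite {2}v0E.
Qed.

(** Finite-dimensional Hahn-Banach: after a shift that makes [h0 0 = 0], the zero form is a minorant
    on the zero subspace, and it is extended one coordinate at a time. *)
Lemma subdifferential_neq0 (h : 'rV[R]_n -> R) x :
  convex_fun h -> exists s, subdifferential h x s.
Proof.
move=> ch; pose h0 v := h (x + v) - h x.
have ch0 : convex_fun h0.
  move=> u v t t01; rewrite /h0.
  have -> : x + (t *: u + (1 - t) *: v) = t *: (x + u) + (1 - t) *: (x + v).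
    by apply/rowP => i; rewrite !mxE; ring.
  by have := ch (x + u) (x + v) t t01; lra.
have h00 : h0 0 = 0 by rewrite /h0 addr0 subrr.
have : forall k, (k <= n)%N -> exists s, agree_below h0 k s.
  elim=> [_|k IH kn].
    exists 0 => v v0; have -> : v = 0 by apply/rowP => i; rewrite v0// mxE.
    by rewrite h00 -(scale0r (0 : 'rV[R]_n)) dotpZl mul0r.
  have [s hs] := IH (ltnW kn).
  exact: (@extend_minorant h0 (Ordinal kn) s).
move=> /(_ n (leqnn n))[s hs]; exists s => y.
have : dotp s (y - x) <= h0 (y - x).
  by apply: hs => i; rewrite leqNgt ltn_ord.
by rewrite /h0 subrKC; lra.
Qed.

End Euclidean.

(** * The proximal operator *)

Section Prox.
Context (R : realType) (n : nat).
Implicit Types (u v w x y z s : 'rV[R]_n) (a b t : R).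

Lemma sqr_enorm_conv x y z t :
  enorm (t *: x + (1 - t) *: y - z) ^+ 2 =
  t * enorm (x - z) ^+ 2 + (1 - t) * enorm (y - z) ^+ 2
  - t * (1 - t) * enorm (x - y) ^+ 2.
Proof.
rewrite !sqr_enorm !dotpE (dotpC y x) (dotpC z x) (dotpC z y); ring.
Qed.

Variable r : 'rV[R]_n -> R.
Hypothesis cr : convex_fun r.
Variable a : R.
Hypothesis a_gt0 : 0 < a.

Let a2_gt0 : 0 < (2 * a)^-1. Proof. by rewrite invr_gt0 mulr_gt0. Qed.

Let q z y := (2 * a)^-1 * enorm (y - z) ^+ 2 + r y.

Let q_conv z x y t : 0 <= t <= 1 ->
  q z (t *: x + (1 - t) *: y) <=
  t * q z x + (1 - t) * q z y - (2 * a)^-1 * (t * (1 - t) * enorm (x - y) ^+ 2).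
Proof.
move=> t01; rewrite /q sqr_enorm_conv.
have := cr x y t01; lra.
Qed.

Let q_convex z : convex_fun (q z).
Proof.
move=> x y t t01; apply: le_trans (q_conv _ _ _ t01) _.
rewrite gerBl mulr_ge0 ?(ltW a2_gt0)// mulr_ge0 ?sqr_ge0//.
by move: t01 => /andP[t0 t1]; rewrite mulr_ge0// subr_ge0.
Qed.

(** A subgradient of [r] at [z] bounds the objective below by a quadratic; completing the square
    gives the minimum [- a / 2 * enorm s ^+ 2] of its nonconstant part. *)
Let q_lbound z : exists m, forall y, m <= q z y.
Proof.
have [s hs] := subdifferential_neq0 z cr.
exists (r z - a / 2 * enorm s ^+ 2) => y; have := hs y.
have := dotp_ge0 ((2 * a)^-1 *: (y - z) + 2^-1 *: s); have a0 := a_gt0.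
rewrite /q !sqr_enorm; move: (y - z) => e.
have -> : dotp ((2 * a)^-1 *: e + 2^-1 *: s) ((2 * a)^-1 *: e + 2^-1 *: s) =
    ((2 * a)^-1 * dotp e e + dotp s e + a / 2 * dotp s s) * (2 * a)^-1.
  by rewrite !dotpE (dotpC e); field; rewrite gt_eqF.
by rewrite pmulr_lge0//; lra.
Qed.

(** Strong convexity makes every minimising sequence Cauchy, and the limit of one is a minimiser. *)
Lemma prox_objective_argmin z :
  exists y, argmin (fun y => (2 * a)^-1 * enorm (y - z) ^+ 2 + r y) y.
Proof.
have [m hm] := q_lbound z.
have hI : has_inf (range (q z)).
  split; first by exists (q z 0), 0.
  by exists m => _ [y _ <-].
set I := inf (range (q z)).
have Ile y : I <= q z y by apply: ge_inf; [exact: hI.2|exists y].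
have /choice[y_ hy] : forall k : nat, exists y, q z y < I + k.+1%:R^-1.
  move=> k; have k0 : 0 < (k.+1%:R : R)^-1 by rewrite invr_gt0.
  by have [_ [y _ <-] ?] := inf_adherent k0 hI; exists y.
(* Strong convexity at the midpoint of [y_ i] and [y_ j], where the objective is still at least
   [I]. *)
have dist i j : enorm (y_ i - y_ j) ^+ 2 <= 4 * a * (i.+1%:R^-1 + j.+1%:R^-1).
  have h01 : 0 <= (2^-1 : R) <= 1.
    by rewrite invr_ge0 ler0n invf_le1 ?ler1n ?ltr0n.
  have h := q_conv z (y_ i) (y_ j) h01.
  have {}h := le_trans (Ile _) h.
  have := hy i; have := hy j.
  move: h; set p := enorm _ ^+ 2; set qi := q z _; set qj := q z _ => h hj hi.
  have : (2 * a)^-1 * p <= 2 * (i.+1%:R^-1 + j.+1%:R^-1).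
    move: h hj hi; move: (i.+1%:R^-1 : R) (j.+1%:R^-1 : R) => di dj.
    rewrite (_ : _ * (_ * _ * p) = (2 * a)^-1 * p / 4); last first.
      by field; rewrite gt_eqF.
    lra.
  rewrite mulrC ler_pdivrMr ?mulr_gt0// => /le_trans; apply.
  by rewrite le_eqVlt; apply/orP; left; apply/eqP; ring.
have cvg_coord c : cvg ((fun i => y_ i 0 c) @ \oo).
  apply/cauchy_cvgP/cauchy_exP => e e0.
  have e1 : 0 < e ^+ 2 / (8 * a) by rewrite divr_gt0 ?exprn_gt0 ?mulr_gt0.
  have [i hi] : exists i : nat, i.+1%:R^-1 < e ^+ 2 / (8 * a).
    have [N _ hN] := near_infty_natSinv_lt (PosNum e1).
    by exists N; exact: (hN N (leqnn N)).
  exists (y_ i 0 c).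
  suff : \forall j \near \oo, `|y_ i 0 c - y_ j 0 c| < e by [].
  near=> j.
  rewrite -(@ltr_pXn2r _ 2) ?nnegrE ?(ltW e0)//.
  have -> : y_ i 0 c - y_ j 0 c = (y_ i - y_ j) 0 c by rewrite !mxE.
  have : `|(y_ i - y_ j) 0 c| ^+ 2 <= enorm (y_ i - y_ j) ^+ 2.
    by rewrite ler_pXn2r ?nnegrE ?enorm_ge0// norm_coord_le.
  move=> /le_lt_trans; apply; apply: le_lt_trans (dist _ _) _.
  have hj : j.+1%:R^-1 < e ^+ 2 / (8 * a)
    by near: j; exact: near_infty_natSinv_lt (PosNum e1).
  have -> : e ^+ 2 = 4 * a * (e ^+ 2 / (8 * a) + e ^+ 2 / (8 * a))
    by field; rewrite gt_eqF.
  by rewrite ltr_pM2l ?mulr_gt0 ?ltrD.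
pose p : 'rV[R]_n := \row_c lim ((fun i => y_ i 0 c) @ \oo).
exists p => y /=; apply: le_trans (Ile y).
(* A subgradient of the objective at the limit [p] supplies lower semicontinuity:
   [q z p + dotp s (y_ k - p)] is at most [q z (y_ k)], hence below [I + k.+1%:R^-1]. *)
have [s hs] := subdifferential_neq0 p (q_convex z).
have cvgq : (fun k => q z p + dotp s (y_ k - p) - k.+1%:R^-1) @ \oo --> q z p + 0 - 0.
  apply: cvgB; last exact: cvg_harmonic.
  apply: cvgD; first exact: cvg_cst.
  rewrite /dotp; elim: (index_enum _) => [|c t IH].
    by under eq_fun do rewrite big_nil; exact: cvg_cst.
  under eq_fun do rewrite big_cons.
  rewrite -[X in nbhs X]addr0; apply: cvgD => //.
  rewrite -(mulr0 (s 0 c)); apply: cvgM; first exact: cvg_cst.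
  under eq_fun do rewrite !mxE.
  rewrite -(subrr (lim ((fun i => y_ i 0 c) @ \oo))).
  by apply: cvgB; [exact: cvg_coord|exact: cvg_cst].
rewrite -/(q z p) -[q z p]addr0 -[_ + 0]subr0.
rewrite -(cvg_lim (@Rhausdorff R) cvgq); apply: limr_le.
  by apply/cvg_ex; exists (q z p + 0 - 0).
near=> k; rewrite lerBlDr; apply: le_trans (hs (y_ k)) _; exact/ltW/hy.
Unshelve. all: by end_near. Qed.

Lemma prox_argmin z :
  argmin (fun y => (2 * a)^-1 * enorm (y - z) ^+ 2 + r y) (prox a r z).
Proof.
by have [y hy] := prox_objective_argmin z; rewrite /prox; case: xgetP => // /(_ y).
Qed.

(** First-order optimality: the minimiser is compared with the points [t *: u + (1 - t) *: y] for
    small [t], where the quadratic term is of order [t ^+ 2]. *)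
Lemma prox_subdifferential z :
  subdifferential r (prox a r z) (a^-1 *: (z - prox a r z)).
Proof.
move=> u; have := prox_argmin z; set y := prox a r z => miny.
pose D := a^-1 * dotp (y - z) (u - y) + r u - r y.
have key t : 0 < t <= 1 -> 0 <= D + t * ((2 * a)^-1 * enorm (u - y) ^+ 2).
  move=> /andP[t0 t1]; have t01 : 0 <= t <= 1 by rewrite ltW.
  have := miny (t *: u + (1 - t) *: y); rewrite /= -/(q z _) -/(q z _).
  move=> /le_trans/(_ (q_conv _ _ _ t01)); rewrite /q.
  have -> : enorm (u - z) ^+ 2 =
      enorm (u - y) ^+ 2 + 2 * dotp (y - z) (u - y) + enorm (y - z) ^+ 2.
    have -> : u - z = (u - y) + (y - z) by rewrite addrA subrK.
    rewrite !sqr_enorm; move: (u - y) (y - z) => e e'.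
    by rewrite !dotpE (dotpC e'); ring.
  rewrite /D -(pmulr_rge0 _ t0).
  have -> : a^-1 = 2 * (2 * a)^-1 by field; rewrite gt_eqF.
  move: (enorm _ ^+ 2) (enorm _ ^+ 2) (dotp _ _) (2 * a)^-1 => p1 p2 p3 b.
  lra.
have D0 : 0 <= D.
  rewrite leNgt; apply/negP => D0.
  set M := (2 * a)^-1 * enorm (u - y) ^+ 2 in key.
  have M0 : 0 <= M by rewrite /M mulr_ge0 ?sqr_ge0 ?(ltW a2_gt0).
  (* If [D] were negative, this [t] would make [D + t * M] equal to [D * (1 - D) / (M + 1 - D)],
     which is negative. *)
  pose t := - D / (M + 1 - D).
  have t01 : 0 < t <= 1.
    by rewrite divr_gt0 ?ler_pdivrMr /=; lra.
  have := key t t01; apply/negP; rewrite -ltNge.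
  have -> : D + t * M = D * (1 - D) / (M + 1 - D) by rewrite /t; field; lra.
  by rewrite pmulr_llt0 ?invr_gt0 ?nmulr_rlt0; lra.
move: D0; rewrite /D.
rewrite -(opprB y z) scalerN dotpNl dotpZl; lra.
Qed.

Lemma subdifferential_monotone (h : 'rV[R]_n -> R) x y s s' :
  subdifferential h x s -> subdifferential h y s' ->
  0 <= dotp (s - s') (x - y).
Proof.
move=> /(_ y) + /(_ x).
rewrite !(dotpDl, dotpDr, dotpNl, dotpNr); lra.
Qed.

(** Monotonicity of the subdifferential and Cauchy-Schwarz. The Lipschitz property later makes the
    prox step measurable for the filtration. *)
Lemma prox_nonexpansive z z' :
  enorm (prox a r z - prox a r z') <= enorm (z - z').
Proof.
have := subdifferential_monotone (@prox_subdifferential z) (@prox_subdifferential z').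
set y := prox a r z; set y' := prox a r z'.
rewrite -scalerBr dotpZl pmulr_rge0 ?invr_gt0//.
have -> : z - y - (z' - y') = (z - z') - (y - y').
  by apply/rowP => i; rewrite !mxE; ring.
rewrite dotpDl dotpNl subr_ge0 -sqr_enorm => /le_trans/(_ (dotp_le_enorm _ _)).
have := enorm_ge0 (y - y'); rewrite le_eqVlt => /predU1P[<- _|y0].
  exact: enorm_ge0.
by rewrite expr2 ler_pM2r.
Qed.

(** Monotonicity between the subgradient that optimality gives at the prox point and the given one
    at [x], followed by Cauchy-Schwarz. *)
Lemma prox_step_le x v s : subdifferential r x s ->
  enorm (prox a r (x - a *: v) - x) <= a * (enorm v + enorm s).
Proof.
move=> hs.
have := subdifferential_monotone (@prox_subdifferential (x - a *: v)) hs.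
set y := prox a r _; rewrite -(pmulr_rge0 _ a_gt0) -dotpZl.
have -> : a *: (a^-1 *: (x - a *: v - y) - s) = a *: (- (v + s)) - (y - x).
  rewrite scalerBr scalerA mulfV ?gt_eqF// scale1r.
  by apply/rowP => i; rewrite !mxE; ring.
rewrite dotpDl dotpNl subr_ge0 -sqr_enorm => /le_trans/(_ (dotp_le_enorm _ _)).
rewrite enormZ enormN (gtr0_norm a_gt0).
have := ler_enormD v s; set E := enorm (v + s) => E1.
have := enorm_ge0 (y - x); rewrite le_eqVlt => /predU1P[<- _|y0].
  by rewrite mulr_ge0 ?(ltW a_gt0)// addr_ge0 ?enorm_ge0.
rewrite expr2 ler_pM2r// => /le_trans; apply.
by rewrite ler_pM2l.
Qed.

End Prox.

Lemma convex_function_fun (R : realType) (n : nat) (h : 'rV[R]_n -> R) :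
  convex_function setT h -> convex_fun h.
Proof.
move=> ch x y t t01; pose t' := Itv01 (andP t01).1 (andP t01).2.
by have := ch t' x y; rewrite !inE; apply.
Qed.

Lemma group_sum_convex (R : realType) (n N : nat) (g : 'I_N -> {set 'I_n})
    (r_ : forall i : 'I_N, 'rV[R]_#|g i| -> R) :
  (forall i, convex_function setT (r_ i)) -> convex_fun (group_sum r_).
Proof.
move=> cr x y t t01; rewrite /group_sum !mulr_sumr -big_split.
apply: ler_sum => i _; apply: le_trans (convex_function_fun (cr i) _ _ t01).
by rewrite le_eqVlt; apply/orP; left; apply/eqP; congr r_; apply/rowP => j; rewrite !mxE.
Qed.

(** * Measurability *)

Lemma measurable_enorm d (T : measurableType d) (R : realType) (n : nat)
    (X : T -> 'rV[R]_n) :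
  (forall i, measurable_fun setT (fun t => X t 0 i)) ->
  measurable_fun setT (fun t => enorm (X t)).
Proof.
move=> mX; have mS : measurable_fun [set: R] (@Num.sqrt R).
  by apply: continuous_measurable_fun; exact: sqrt_continuous.
apply: (measurableT_comp mS); apply: measurable_sum => i.
exact: measurable_funM.
Qed.

(** By the Lipschitz property [H (X t) t] is the infimum of [H q t + K * enorm (X t - q)] over
    rational points [q], so each strict sublevel set is a countable union of measurable sets. *)
Lemma measurable_lipschitz_comp d (T : measurableType d) (R : realType)
    (n : nat) (H : 'rV[R]_n -> T -> R) (K : R) (X : T -> 'rV[R]_n) :
  0 < K ->
  (forall q, measurable_fun setT (H q)) ->
  (forall t p q, H p t - H q t <= K * enorm (p - q)) ->
  (forall i, measurable_fun setT (fun t => X t 0 i)) ->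
  measurable_fun setT (fun t => H (X t) t).
Proof.
move=> K0 mH lipH mX _.
apply: (measurability _ (RGenInftyO.measurableE R)) => //.
move=> _ [_ [a ->] <-]; rewrite setTI.
pose q (N : nat) (p : 'rV[int]_n) : 'rV[R]_n := \row_i ((p 0 i)%:~R / N.+1%:R).
pose E k := if (unpickle k : option (nat * 'rV[int]_n)) is Some Np
  then [set t | H (q Np.1 Np.2) t + K * enorm (X t - q Np.1 Np.2) < a]
  else set0.
rewrite [X in measurable X](_ : _ = \bigcup_k E k).
  apply: bigcupT_measurable => k; rewrite /E; case: unpickle => // -[N p] /=.
  rewrite -[X in measurable X]setTI.
  pose h t := H (q N p) t + K * enorm (X t - q N p).
  have mh : measurable_fun setT h.
    apply: measurable_funD => //; apply: measurable_funM => //.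
    apply: measurable_enorm => i; under eq_fun do rewrite !mxE.
    by apply: measurable_funB.
  rewrite (_ : [set t | _] = h @^-1` `]-oo, a[%classic).
    by apply: mh => //; exact: measurable_itv.
  by apply/seteqP; split => t /=; rewrite in_itv.
apply/seteqP; split => t /=; rewrite in_itv /=.
  move=> ha.
  (* A grid point within [e] in each coordinate costs at most [2 * K * (n.+1%:R * e)]; dividing by
     [n.+2] rather than [n.+1] makes the final inequality strict. *)
  pose e := (a - H (X t) t) / (2 * K * n.+2%:R).
  have e0 : 0 < e by rewrite divr_gt0 ?subr_gt0 ?mulr_gt0.
  have [N _ hN] := near_infty_natSinv_lt (PosNum e0).
  have {}hN := hN N (leqnn N).
  pose p : 'rV[int]_n := \row_i Num.floor (X t 0 i * N.+1%:R).
  have hp : enorm (X t - q N p) <= n.+1%:R * e.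
    apply: enorm_le_coord; first exact: ltW.
    move=> i; rewrite !mxE; apply: le_trans (ltW hN).
    have N0 : 0 < N.+1%:R :> R by [].
    rewrite /= -[X in `|X|](mulfK (lt0r_neq0 N0)) normrM normfV (gtr0_norm N0).
    rewrite ler_pdivrMr ?mulVf ?lt0r_neq0// mulrBl divfK ?lt0r_neq0//.
    have := Num.Theory.floor_itv (X t 0 i * N.+1%:R).
    by rewrite intrD => /andP[h1 h2]; rewrite ger0_norm; lra.
  exists (pickle (N, p)) => //; rewrite /E pickleK /=.
  have := lipH t (q N p) (X t); rewrite enormB => h.
  have {h hp} : H (q N p) t + K * enorm (X t - q N p) <=
      H (X t) t + 2 * K * (n.+1%:R * e).
    have := ler_wpM2l (ltW K0) hp; lra.
  move=> /le_lt_trans; apply.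
  have -> : a = H (X t) t + 2 * K * (n.+2%:R * e).
    by rewrite /e; field; rewrite (gt_eqF K0) andbT -natrD pnatr_eq0.
  by rewrite ltrD2l ltr_pM2l ?mulr_gt0// ltr_pM2r// ltr_nat.
move=> [k _]; rewrite /E; case: unpickle => // -[N p] /=.
by apply: le_lt_trans; have := lipH t (X t) (q N p); lra.
Qed.

(** * Integration of almost sure bounds *)

Section AlmostEverywhere.
Context d (T : measurableType d) (R : realType) (mu : probability T R).
Implicit Types f g : T -> R.

Lemma ae_le_integrable f g : measurable_fun setT f ->
  mu.-integrable setT (EFin \o g) -> {ae mu, forall x, `|f x| <= g x} ->
  mu.-integrable setT (EFin \o f).
Proof.
move=> mf ig fg; apply/integrableP; split; first exact/measurable_EFinP.
have /integrableP[mg] := ig; apply: le_lt_trans.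
apply: ae_ge0_le_integral => //.
- by apply: measurableT_comp => //; exact/measurable_EFinP.
- exact: measurableT_comp.
- by apply: filterS fg => x h _ /=; rewrite lee_fin (le_trans h)// ler_norm.
Qed.

Lemma ae_bounded_integrable f M : measurable_fun setT f ->
  {ae mu, forall x, `|f x| <= M} -> mu.-integrable setT (EFin \o f).
Proof.
move=> mf fM; apply: (ae_le_integrable mf _ fM).
exact: finite_measure_integrable_cst.
Qed.

Lemma ae_le_Rintegral f g : mu.-integrable setT (EFin \o f) ->
  mu.-integrable setT (EFin \o g) -> {ae mu, forall x, f x <= g x} ->
  \int[mu]_x f x <= \int[mu]_x g x.
Proof.
move=> If Ig fg; rewrite -subr_ge0 -RintegralB//.
have mf : measurable_fun setT f by exact/measurable_EFinP/(measurable_int _ If).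
have mg : measurable_fun setT g by exact/measurable_EFinP/(measurable_int _ Ig).
have E : (\int[mu]_x (g x - f x)%:E = \int[mu]_x `|g x - f x|%:E)%E.
  apply: ae_eq_integral => //.
  - by apply/measurable_EFinP; exact: measurable_funB.
  - apply/measurable_EFinP; apply: (measurableT_comp (@normr_measurable _ _)).
    exact: measurable_funB.
  - by move: fg; apply: filterS => x h _; rewrite ger0_norm// subr_ge0; exact: h.
by rewrite /Rintegral E; apply: fine_ge0; apply: integral_ge0 => x _; rewrite lee_fin.
Qed.

Lemma ae_le_norm_Rintegral f M : measurable_fun setT f ->
  {ae mu, forall x, `|f x| <= M} -> `|\int[mu]_x f x| <= M.
Proof.
move=> mf fM; have If := ae_bounded_integrable mf fM.
have IM k : mu.-integrable setT (EFin \o cst k) by exact: finite_measure_integrable_cst.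
have cstE k : \int[mu]_x (cst k x) = k.
  by rewrite Rintegral_cst// [X in _ * fine X]probability_setT mulr1.
rewrite ler_norml -{1}(cstE (- M)) -[X in _ && (_ <= X)](cstE M).
apply/andP; split.
- apply: ae_le_Rintegral => //.
  by apply: filterS fM => x /=; rewrite ler_norml => /andP[].
- apply: ae_le_Rintegral => //.
  by apply: filterS fM => x /=; rewrite ler_norml => /andP[].
Qed.

Lemma ae_eq_Rintegral f g : measurable_fun setT f -> measurable_fun setT g ->
  {ae mu, forall x, f x = g x} -> \int[mu]_x f x = \int[mu]_x g x.
Proof.
move=> mf mg fg; rewrite /Rintegral; congr fine; apply: ae_eq_integral => //.
- exact/measurable_EFinP.
- exact/measurable_EFinP.
- by apply: filterS fg => x -> _.
Qed.

End AlmostEverywhere.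

(** * Differentiation under the expectation *)

Section Gradient.
Context (R : realType) (n : nat).
Implicit Types (h : 'rV[R]_n -> R^o) (q v : 'rV[R]_n).

(** For [t] in ]0, 1], convexity bounds the difference quotient along [v] by [h (q + v) - h q]; the
    bound survives the limit from the right. *)
Lemma convex_derive_le h q v : convex_fun h -> derivable h q v ->
  h q + 'D_v h q <= h (q + v).
Proof.
move=> ch dh.
suff : 'D_v h q <= h (q + v) - h q by lra.
have dh' : (fun t : R => t^-1 * (h (t *: v + q) - h q)) @ 0^'+ --> ('D_v h q : R).
  exact: cvg_dnbhs_at_right dh.
apply: (cvgr_to_le dh'); near=> t.
have t0 : 0 < t by near: t; exact: nbhs_right_gt.
have t1 : t <= 1 by near: t; exact: nbhs_right_le.
rewrite mulrC ler_pdivrMr//.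
have t01 : 0 <= t <= 1 by rewrite t1 ltW.
have := ch (q + v) q t t01.
have -> : t *: (q + v) + (1 - t) *: q = t *: v + q.
  by apply/rowP => i; rewrite !mxE; ring.
lra.
Unshelve. all: by end_near. Qed.

(** Tangent inequalities at both end points put the remainder between 0 and [t] times the increment
    of the partial derivative, which the Lipschitz property bounds by [L * |t|]. *)
Lemma gradient_quadratic_bound h (L : R) q (j : 'I_n) (t : R) :
  convex_fun h -> (forall x, differentiable h x) ->
  (forall x y, enorm (gradient h x - gradient h y) <= L * enorm (x - y)) ->
  `|h (q + t *: delta_mx 0 j) - h q - t * gradient h q 0 j| <= L * t ^+ 2.
Proof.
move=> ch dh lh; set e : 'rV[R]_n := delta_mx 0 j.
have DE x s : 'D_(s *: e) h x = s * gradient h x 0 j.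
  by rewrite mxE !deriveE// linearZ.
have le1 x s : h x + s * gradient h x 0 j <= h (x + s *: e).
  by rewrite -DE; apply: convex_derive_le => //; exact: diff_derivable.
have h1 := le1 q t; have := le1 (q + t *: e) (- t).
rewrite scaleNr addrK => h2.
have e1 : enorm e = 1.
  rewrite /enorm /dotp (bigD1 j)//= big1 => [|i ij].
    by rewrite mxE !eqxx mulr1 addr0 sqrtr1.
  by rewrite mxE (negbTE ij) andbF mulr0.
have : `|gradient h (q + t *: e) 0 j - gradient h q 0 j| <= L * `|t|.
  have := lh (q + t *: e) q; rewrite [q + _]addrC addrK enormZ e1 mulr1.
  apply: le_trans; apply: le_trans (norm_coord_le _ j).
  by rewrite !mxE.
move=> /(ler_wpM2l (normr_ge0 t)); rewrite -normrM => h3.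
have -> : L * t ^+ 2 = `|t| * (L * `|t|).
  by rewrite -(real_normK (num_real t)); ring.
apply: le_trans h3; rewrite [leLHS]ger0_norm; last by lra.
by apply: (le_trans _ (ler_norm _)); rewrite mulrBr; lra.
Qed.

Lemma derive_quadratic_bound h q v (D L : R) :
  (forall t, `|h (q + t *: v) - h q - t * D| <= L * t ^+ 2) -> 'D_v h q = D.
Proof.
move=> hq; apply: cvg_lim; first exact: Rhausdorff.
have L0 : 0 <= L by have := hq 1; rewrite expr1n mulr1; apply: le_trans (normr_ge0 _).
apply/cvgrPdist_le => /= e e0.
have e1 : 0 < e / (L + 1) by rewrite divr_gt0//; lra.
near=> t.
have t0 : t != 0 by near: t; exact: nbhs_dnbhs_neq.
have tL : `|t| * (L + 1) <= e.
  rewrite -ler_pdivlMr; last by lra.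
  near: t; exact: (@dnbhs0_le R R^o).
apply: le_trans tL; rewrite -[_ *: _]/(t^-1 * _) distrC.
rewrite -{1}[D](mulKf t0) -mulrBr normrM normfV ler_pdivrMl ?normr_gt0//.
rewrite /= [t *: v + q]addrC; apply: le_trans (hq t) _.
rewrite -(real_normK (num_real t)) expr2.
have := sqr_ge0 `|t|; rewrite expr2; lra.
Unshelve. all: by end_near. Qed.

End Gradient.

Section ExpectedGradient.
Context (R : realType) (n : nat) (dX : measure_display)
  (Xi : measurableType dX) (P : probability Xi R) (l : 'rV[R]_n -> Xi -> R).
Local Notation grad_l := (fun x z => gradient (l ^~ z : 'rV[R]_n -> R^o) x).

(** [G] equals the sample gradient off a null set [N] and 0 on [N], so that Lipschitz continuity and
    measurability hold everywhere. The quadratic bound on the remainder replaces dominated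
    convergence in exchanging gradient and expectation. *)
Lemma gradient_expected_loss (Lg : R) : smooth_convex_loss P l -> 0 < Lg ->
  {ae P, forall z, forall x y : 'rV[R]_n,
    enorm (grad_l x z - grad_l y z) <= Lg * enorm (x - y)} ->
  exists G : 'rV[R]_n -> Xi -> 'rV[R]_n,
  [/\ {ae P, forall z, forall q, G q z = grad_l q z},
      forall z p q, enorm (G p z - G q z) <= Lg * enorm (p - q),
      forall q j, measurable_fun setT (fun z => G q z 0 j),
      forall q j, P.-integrable setT (EFin \o (fun z => G q z 0 j)) &
      forall q j, \int[P]_z (G q z 0 j) = gradient (expected_loss P l) q 0 j].
Proof.
move=> [il sl] Lg0 ll.
have [N [mN PN hN]] : P.-negligible (~` [set z |
  ((forall x, differentiable (l ^~ z : 'rV[R]_n -> R^o) x) /\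
    convex_function setT (l ^~ z)) /\
   forall x y : 'rV[R]_n,
    enorm (grad_l x z - grad_l y z) <= Lg * enorm (x - y)]).
  by apply: filterS2 sl ll => z h1 h2; split.
have good z : ~ N z -> (forall x, differentiable (l ^~ z : 'rV[R]_n -> R^o) x) /\
    convex_fun (l ^~ z) /\
   forall x y : 'rV[R]_n,
    enorm (grad_l x z - grad_l y z) <= Lg * enorm (x - y).
  move=> Nz; have [[h1 h2] h3] : [set z |
      ((forall x, differentiable (l ^~ z : 'rV[R]_n -> R^o) x) /\
       convex_function setT (l ^~ z)) /\
      forall x y : 'rV[R]_n,
        enorm (grad_l x z - grad_l y z) <= Lg * enorm (x - y)] z.
    by apply: contrapT => h; apply/Nz/hN.
  by split => //; split => //; exact: convex_function_fun.
pose G q z := \1_(~` N) z *: grad_l q z.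
have ind1 z : ~ N z -> \1_(~` N) z = 1 :> R by move=> Nz; rewrite indicE mem_set.
have ind0 z : N z -> \1_(~` N) z = 0 :> R.
  by move=> Nz; rewrite indicE memNset// => /(_ Nz).
have GN z q : ~ N z -> G q z = grad_l q z by move=> Nz; rewrite /G ind1// scale1r.
have G0 z q : N z -> G q z = 0 by move=> Nz; rewrite /G ind0// scale0r.
have aeN : {ae P, forall z, ~ N z}.
  by exists N; split => // z /= /contrapT.
have quad z q j t : ~ N z ->
    `|l (q + t *: delta_mx 0 j) z - l q z - t * G q z 0 j| <= Lg * t ^+ 2.
  move=> Nz; rewrite GN//; have [h1 [h2 h3]] := good _ Nz.
  exact: (@gradient_quadratic_bound _ _ (l ^~ z) Lg q j t).
have ml q : measurable_fun setT (l q).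
  exact/measurable_EFinP/(measurable_int _ (il q)).
have mG q j : measurable_fun setT (fun z => G q z 0 j).
  (* Difference quotients with increment [k.+1%:R^-1], cut off on [N]: measurable functions that
     converge pointwise to the coordinate of [G]. *)
  pose u (k : nat) z := \1_(~` N) z *
    (k.+1%:R * (l (q + k.+1%:R^-1 *: delta_mx 0 j) z - l q z)).
  apply: (@measurable_fun_cvg _ _ _ _ u).
    move=> k; apply: measurable_funM.
      by apply: measurable_indic; exact: measurableC.
    by apply: measurable_funM => //; exact: measurable_funB.
  move=> z _; have [Nz|Nz] := pselect (N z).
    rewrite G0// mxE /u; under eq_fun do rewrite ind0// mul0r.
    exact: cvg_cst.
  under eq_fun do rewrite /u ind1// mul1r.
  apply/cvgrPdist_le => /= e e0; have e1 : 0 < e / Lg by rewrite divr_gt0.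
  near=> k.
  have k0 : 0 < k.+1%:R :> R by [].
  have ke : k.+1%:R^-1 <= e / Lg.
    by apply: ltW; near: k; exact: near_infty_natSinv_lt (PosNum e1).
  have := quad z q j k.+1%:R^-1 Nz.
  move=> /(ler_wpM2l (ltW k0)); rewrite -{1}(gtr0_norm k0) -normrM.
  have -> : k.+1%:R * (Lg * k.+1%:R^-1 ^+ 2) = Lg * k.+1%:R^-1.
    by rewrite expr2 mulrCA mulVKf ?gt_eqF.
  rewrite distrC mulrBr mulVKf ?gt_eqF// => /le_trans; apply.
  by rewrite mulrC -ler_pdivlMr.
have iG q j : P.-integrable setT (EFin \o (fun z => G q z 0 j)).
  pose e : 'rV[R]_n := delta_mx 0 j.
  (* The quadratic bound with [t = 1] dominates [G] by an increment of the loss plus [Lg]. *)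
  apply: (@ae_le_integrable _ _ _ _ _ (fun z => `|l (q + e) z - l q z| + Lg)) => //.
    have I1 : P.-integrable setT (EFin \o (fun z => l (q + e) z - l q z)).
      exact: (integrableB measurableT (il _) (il _)).
    have I2 := @finite_measure_integrable_cst _ _ _ P setT Lg measurableT.
    exact: (integrableD measurableT (integrable_abse I1) I2).
  apply: filterS aeN => z /(quad z q j 1).
  rewrite scale1r mul1r expr1n mulr1 -/e => h.
  rewrite -[G q z 0 j](subKr (l (q + e) z - l q z)).
  by apply: le_trans (ler_normB _ _) _; rewrite lerD2l.
exists G; split => //.
- by apply: filterS aeN => z Nz q; exact: GN.
- move=> z p q; have [Nz|Nz] := pselect (N z).
    by rewrite !G0// subrr enorm0 mulr_ge0 ?enorm_ge0// ltW.
  by rewrite !GN//; have [_ [_ ]] := good _ Nz; apply.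
- move=> q j; rewrite mxE; symmetry.
  (* The quadratic bound holds for almost every sample; its integral is the same bound for
     [expected_loss P l], which identifies the partial derivative. *)
  apply: (@derive_quadratic_bound _ _ _ _ _ _ Lg) => t.
  have ->: expected_loss P l = fun q => \int[P]_z (l q z).
    by apply/funext => x; rewrite /expected_loss unlock.
  rewrite -RintegralZl// -!RintegralB//=; last 2 first.
  - exact: (integrableB measurableT (il _) (il _)).
  - exact: (integrableZl measurableT _ (iG q j)).
  apply: ae_le_norm_Rintegral.
    apply: measurable_funB; first exact: measurable_funB.
    exact: measurable_funM.
  by apply: filterS aeN => z /(quad z q j t).
Unshelve. all: by end_near. Qed.

End ExpectedGradient.

(** * Independence and the filtration *)

Section Independence.
Context (R : realType) (dO dX : measure_display) (Omega : measurableType dO)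
  (Xi : measurableType dX) (Pr : probability Omega R) (P : probability Xi R).

(** Independence makes the joint law of [A] and [X] a product measure; in Fubini's theorem the inner
    integral over [P] vanishes. *)
Lemma integral_independent_eq0 d1 (T1 : measurableType d1) (A : Omega -> T1)
    (X : {RV Pr >-> Xi}) (h : T1 -> Xi -> R) :
  measurable_fun setT A -> has_law P X ->
  (forall B C, measurable B -> measurable C ->
    Pr ((X @^-1` C) `&` (A @^-1` B)) = (Pr (X @^-1` C) * Pr (A @^-1` B))%E) ->
  measurable_fun setT (fun az : T1 * Xi => h az.1 az.2) ->
  Pr.-integrable setT (EFin \o (fun w => h (A w) (X w))) ->
  (forall a, \int[P]_z h a z = 0) ->
  (forall a, P.-integrable setT (EFin \o h a)) ->
  \int[Pr]_w h (A w) (X w) = 0.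
Proof.
move=> mA lawX indAX mh ih h0 ih1.
have mX : measurable_fun setT X by exact: measurable_funP.
pose A' : {RV Pr >-> T1} :=
  MeasurableFun.Pack (MeasurableFun.Class (isMeasurableFun.Build _ _ _ _ _ mA)).
have mAX : measurable_fun setT (fun w => (A w, X w)) by exact: measurable_fun_pair.
pose AX : {RV Pr >-> (T1 * Xi)%type} :=
  MeasurableFun.Pack (MeasurableFun.Class (isMeasurableFun.Build _ _ _ _ _ mAX)).
pose hh := EFin \o (fun az : T1 * Xi => h az.1 az.2).
have mhh : measurable_fun setT hh by exact/measurable_EFinP.
have prodE : forall E, measurable E ->
    (distribution Pr A' \x P)%E E = distribution Pr AX E.
  apply: product_measure_unique => B C mB mC.
  transitivity (Pr ((X @^-1` C) `&` (A @^-1` B))).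
    by rewrite setIC.
  rewrite (indAX B C mB mC) muleC; congr (_ * _)%E; exact: lawX.
have intE : (\int[Pr]_w (h (A w) (X w))%:E =
             \int[distribution Pr A' \x P]_az hh az)%E.
  rewrite (eq_measure_integral (distribution Pr AX)).
    by rewrite (@integral_distribution _ _ _ _ _ Pr AX hh).
  by move=> E mE _; exact: prodE.
have iprod : (distribution Pr A' \x P)%E.-integrable setT hh.
  apply/integrableP; split => //.
  rewrite (eq_measure_integral (distribution Pr AX)); last first.
    by move=> E mE _; exact: prodE.
  have mah : measurable_fun setT (abse \o hh) by exact: measurableT_comp.
  have ah0 : forall az, (0 <= (abse \o hh) az)%E by move=> az; exact: abse_ge0.
  rewrite (ge0_integral_distribution AX mah ah0).
  by case/integrableP : ih.
transitivity (fine (\int[distribution Pr A' \x P]_az hh az)%E); first by rewrite -intE.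
rewrite -integral12_prod_meas1//.
rewrite /fubini_F integral0_eq// => a _.
rewrite -[LHS]fineK; first by congr EFin; exact: (h0 a).
exact: (integrable_fin_num measurableT (ih1 a)).
Qed.

Context (m : nat) (xi : nat -> 'I_m -> {RV Pr >-> Xi}).

Definition filtration_generator (k : nat) : set (set Omega) :=
  [set B | exists (t : nat) (i : 'I_m) (A : set Xi),
         [/\ (1 <= t < k)%N, measurable A & B = xi t i @^-1` A]].

(** The set [Omega] with the sigma-algebra F_k as its measurable structure, so that
    F_k-measurability becomes ordinary measurability on this type. *)
Definition filtered_space (k : nat) := g_sigma_algebraType (filtration_generator k).

Lemma filtration_measurable k B : filtration xi k B -> measurable B.
Proof.
apply: smallest_sub; first exact: sigma_algebra_measurable.
move=> _ [t [i [A [_ mA ->]]]]; rewrite -[X in measurable X]setTI.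
exact: measurable_funP.
Qed.

Lemma filtration_mono k k' : (k <= k')%N -> filtration xi k `<=` filtration xi k'.
Proof.
move=> kk'; apply: sub_sigma_algebra2 => _ [t [i [A [/andP[t1 tk] mA ->]]]].
by exists t, i, A; split => //; rewrite t1 (leq_trans tk).
Qed.

Lemma measurable_filtered_mono d (T : measurableType d) k k' (X : Omega -> T) :
  (k <= k')%N ->
  measurable_fun [set: filtered_space k] (X : filtered_space k -> T) ->
  measurable_fun [set: filtered_space k'] (X : filtered_space k' -> T).
Proof. by move=> kk' mX _ B mB; apply: (filtration_mono kk'); exact: mX. Qed.

Lemma measurable_filtered_sample k t i : (1 <= t < k)%N ->
  measurable_fun [set: filtered_space k] (xi t i : filtered_space k -> Xi).
Proof.
move=> tk _ B mB; rewrite setTI; apply: sub_sigma_algebra.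
by exists t, i, B.
Qed.

(** A pi-system argument: cylinders over samples before iteration [k] generate F_k, and the
    restriction of [Pr] to the sample event agrees on them with a multiple of [Pr]; both are finite
    measures, hence agree on F_k. *)
Lemma sample_independent k t i : iid_samples P xi -> (1 <= k)%N -> (k <= t)%N ->
  independent_of (xi t i) (filtration xi k).
Proof.
move=> [_ ind] k1 kt A B mA.
have t1 := leq_trans k1 kt.
pose D (s : seq (nat * 'I_m)) := forall p, p \in s -> (1 <= p.1 < k)%N.
pose cyl (s : seq (nat * 'I_m)) (C : nat * 'I_m -> set Xi) :=
  \bigcap_(p in [set` s]) (xi p.1 p.2 @^-1` C p).
pose G : set (set Omega) := [set E | exists s C,
  [/\ uniq s, D s, forall p, measurable (C p) & E = cyl s C]].
have mpre p C : measurable C -> measurable (xi p.1 p.2 @^-1` C).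
  by move=> mC; rewrite -[X in measurable X]setTI; exact: measurable_funP.
have mG : G `<=` measurable.
  move=> _ [s [C [_ _ mC ->]]]; apply: fin_bigcap_measurable => //.
  by move=> p _; exact: mpre.
have GI : setI_closed G.
  move=> _ _ [s [C [us Ds mC ->]]] [s' [C' [us' Ds' mC' ->]]].
  exists (undup (s ++ s')), (fun p => (if p \in s then C p else setT) `&`
                                     (if p \in s' then C' p else setT)).
  split; first exact: undup_uniq.
  - by move=> p; rewrite mem_undup mem_cat => /orP[/Ds|/Ds'].
  - by move=> p; apply: measurableI; case: ifP.
  - rewrite /cyl; apply/seteqP; split => w /=.
      move=> [h h'] p /=; rewrite mem_undup mem_cat => _.
      by split; case: ifPn => // ps; [exact: h|exact: h'].
    move=> h; split => p /= ps.
      by have := h p; rewrite /= mem_undup mem_cat ps /= => /(_ isT)[].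
    by have := h p; rewrite /= mem_undup mem_cat ps orbT /= => /(_ isT)[].
have genG : filtration_generator k `<=` <<s G >>.
  move=> _ [t' [i' [A' [t'k mA' ->]]]]; apply: sub_sigma_algebra.
  exists [:: (t', i')], (fun=> A'); split => //.
    by move=> p; rewrite inE => /eqP ->.
  rewrite /cyl; apply/seteqP; split => w /=.
    by move=> h p; rewrite /= inE => /eqP ->.
  by move=> /(_ (t', i')); rewrite /= inE eqxx; apply.
move=> FB; have {FB} GB : <<s G >> B.
  by move: FB; apply: smallest_sub => //; exact: smallest_sigma_algebra.
have mD := mpre (t, i) A mA.
pose r := NngNum (fine_ge0 (measure_ge0 Pr (xi t i @^-1` A))).
have rE : r%:num%:E = Pr (xi t i @^-1` A).
  by rewrite /= fineK// fin_num_measure.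
have GT : G setT.
  by exists [::], (fun=> setT); split => //; apply/seteqP; split => // w _ p.
have cover : \bigcup_(k : nat) (setT : set Omega) = setT.
  by rewrite bigcup_const//; exists 0%N.
have agree : forall E, G E -> mrestr Pr mD E = mscale r Pr E.
  move=> _ [s [C [us Ds mC ->]]]; rewrite /mscale rE /mrestr.
  have tis : (t, i) \notin s.
    by apply/negP => /Ds /= /andP[_]; rewrite ltnNge kt.
  have D1 p : p \in s -> (1 <= p.1)%N by move=> /Ds/andP[].
  have E1 : Pr (cyl s C) = (\prod_(p <- s) Pr (xi p.1 p.2 @^-1` C p))%E.
    exact: (ind s C us D1 mC).
  (* As [k <= t], the index [(t, i)] is not in [s], so mutual independence applies to the family
     enlarged by it. *)
  pose C2 p := if p == (t, i) then A else C p.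
  have E2 : Pr (cyl ((t, i) :: s) C2) = (Pr (xi t i @^-1` A) * Pr (cyl s C))%E.
    transitivity (\prod_(p <- (t, i) :: s) Pr (xi p.1 p.2 @^-1` C2 p))%E.
      apply: (ind ((t, i) :: s) C2); first by rewrite /= tis us.
      - by move=> p; rewrite inE => /predU1P[->|/D1].
      - by move=> p; rewrite /C2; case: eqP.
    rewrite big_cons E1 {1}/C2 eqxx; congr (_ * _)%E.
    apply: eq_big_seq => p ps; rewrite /C2.
    by case: eqP => // pE; rewrite pE (negbTE tis) in ps.
  rewrite [RHS](esym E2) /C2 /cyl.
  congr (Pr _); apply/seteqP; split => w /=.
    move=> [h hA] p /=; rewrite inE => /predU1P[->|ps]; first by rewrite eqxx.
      by case: eqP => [pE|_]; [rewrite pE|exact: h].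
    move=> h; split.
      move=> p /= ps; have := h p; rewrite /= inE ps orbT => /(_ isT).
      by case: eqP => // pE; rewrite pE (negbTE tis) in ps.
    by have := h (t, i); rewrite /= inE eqxx /=; apply.
have fin : forall k : nat, (mrestr Pr mD setT < +oo)%E.
  move=> _; rewrite /mrestr setTI; apply: le_lt_trans (ltry 1).
  exact: probability_le1.
have := @g_sigma_algebra_measure_unique _ _ _ G mG (fun=> setT) (fun=> GT) cover
  (mrestr Pr mD) (mscale r Pr) GI agree fin B GB.
by rewrite setIC /mrestr /= /mscale rE.
Qed.

End Independence.

(** * Sub-Gaussian bounds *)

(** For [x] at most 1/2, [expR x] is at most [(1 - x)^-1], hence at most [1 + x + 2 * x ^+ 2];
    beyond 1/2, [x] itself is below [2 * x ^+ 2]. *)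
Lemma expR_le_addr_expR_sqr (R : realType) (x : R) :
  expR x <= x + expR (2 * x ^+ 2).
Proof.
have [x2|x2] := leP x 2^-1.
  have h1 : 1 - x <= expR (- x) by exact: expR_ge1Dx.
  have h2 : 1 + 2 * x ^+ 2 <= expR (2 * x ^+ 2) by exact: expR_ge1Dx.
  have h3 : expR x * expR (- x) = 1 by rewrite expRN divff ?gt_eqF ?expR_gt0.
  have x1 : 0 < 1 - x by lra.
  have : expR x <= (1 - x)^-1.
    rewrite -[leRHS]mul1r ler_pdivlMr//.
    by rewrite -[leRHS]h3 ler_pM2l ?expR_gt0.
  move=> /le_trans; apply; apply: (@le_trans _ _ (1 + x + 2 * x ^+ 2)); last by lra.
  rewrite -[leLHS]mul1r ler_pdivrMr//.
  have : 0 <= x ^+ 2 * (1 - 2 * x) by rewrite mulr_ge0 ?sqr_ge0//; lra.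
  lra.
have : expR x <= expR (2 * x ^+ 2).
  rewrite ler_expR expr2 mulrA -[leLHS]mul1r ler_pM2r; lra.
lra.
Qed.

(** The summand [2 * c] of the constant serves the phase where beta is 1/2, and [c ^+ 2 / (c - 1)]
    the phase where it is [c / k.+1%:R]. *)
Lemma step_size_recursion (R : realType) (c b K : R) (beta : R) (k : nat) :
  1 < c -> 0 <= b -> b * (c ^+ 2 / (c - 1) + 2 * c) <= K -> (1 <= k)%N ->
  beta = Num.min (1 / 2) (c / k.+1%:R) ->
  (1 - beta) ^+ 2 * (K / k.+1%:R) + b * beta ^+ 2 <= K / k.+2%:R.
Proof.
move=> c1 b0 bK k1 ->.
have [q qE] : exists q : R, q = k.+1%:R by exists k.+1%:R.
have q2 : 2 <= q by rewrite qE ler_nat ltnS.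
rewrite -[k.+2%:R]natr1 -qE.
have q0 : 0 < q by lra.
have cc : 0 <= c ^+ 2 / (c - 1) by rewrite divr_ge0 ?sqr_ge0//; lra.
have K0 : 0 <= K by apply: le_trans bK; rewrite mulr_ge0//; lra.
have [h|h] := leP (1 / 2) (c / q).
  have qc : q <= 2 * c by move: h; rewrite ler_pdivlMr//; lra.
  have bqK : b * q <= K.
    apply: le_trans bK; apply: ler_wpM2l => //; lra.
  rewrite ler_pdivlMr; last by lra.
  have -> : ((1 - 1 / 2) ^+ 2 * (K / q) + b * (1 / 2) ^+ 2) * (q + 1) =
    (K + b * q) * (q + 1) / (4 * q) by field; lra.
  rewrite ler_pdivrMr; last by lra.
  have : (K + b * q) * (q + 1) <= (K + K) * (q + 1).
    by rewrite ler_wpM2r//; lra.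
  move=> /le_trans; apply.
  have : 0 <= K * (q - 1) by rewrite mulr_ge0//; lra.
  lra.
have {h}t12 : c / q <= 1 / 2 by exact: ltW.
have t0 : 0 < c / q by rewrite divr_gt0//; lra.
have h1 : (1 - c / q) ^+ 2 * (K / q) <= (1 - c / q) * (K / q).
  rewrite ler_wpM2r ?divr_ge0 ?(ltW q0)// expr2 -[leRHS]mul1r ler_wpM2r//; lra.
apply: le_trans (lerD h1 (lexx _)) _.
have -> : (1 - c / q) * (K / q) + b * (c / q) ^+ 2 =
  (K * q - (c * K - b * c ^+ 2)) / q ^+ 2 by field; lra.
(* The contraction gains [c * K] and the noise costs [b * c ^+ 2], both over [q ^+ 2]; since
   [c > 1], a net gain of [K] remains. *)
have cK : K <= c * K - b * c ^+ 2.
  have : b * (c ^+ 2 / (c - 1)) <= K.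
    by apply: le_trans bK; rewrite ler_wpM2l//; lra.
  by rewrite mulrA ler_pdivrMr; lra.
rewrite ler_pdivrMr ?exprn_gt0// mulrAC ler_pdivlMr; last by lra.
have : (K * q - (c * K - b * c ^+ 2)) * (q + 1) <= (K * q - K) * (q + 1).
  by rewrite ler_wpM2r//; lra.
move=> /le_trans; apply; rewrite -subr_ge0.
by have -> : K * q ^+ 2 - (K * q - K) * (q + 1) = K by ring.
Qed.

Section SubGaussian.
Context d (T : measurableType d) (R : realType) (Pr : probability T R).

(** One Azuma step, with [W] the exponential of the past and [psi] the innovation: in the bound of
    [expR (lam * psi w)] by [lam * psi w] plus a constant, the linear term integrates to 0 against
    [W]. *)
Lemma subgaussian_step (W psi : T -> R) (b lam : R) :
  measurable_fun setT psi ->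
  (forall w, 0 <= W w) -> Pr.-integrable setT (EFin \o W) ->
  {ae Pr, forall w, `|psi w| <= b} ->
  \int[Pr]_w (W w * psi w) = 0 ->
  Pr.-integrable setT (EFin \o (fun w => W w * expR (lam * psi w))) /\
  \int[Pr]_w (W w * expR (lam * psi w)) <=
    expR (2 * (lam * b) ^+ 2) * \int[Pr]_w W w.
Proof.
move=> mpsi W0 iW psib Wpsi0.
have mW : measurable_fun setT W by exact/measurable_EFinP/(measurable_int _ iW).
have iZ a : Pr.-integrable setT (EFin \o (fun w => a * W w)).
  exact: (integrableZl measurableT a iW).
have iWpsi : Pr.-integrable setT (EFin \o (fun w => W w * psi w)).
  apply: (ae_le_integrable _ (iZ b)); first exact: measurable_funM.
  apply: filterS psib => w h.
  by rewrite normrM ger0_norm// mulrC ler_wpM2r.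
have mE : measurable_fun setT (fun w => W w * expR (lam * psi w)).
  apply: measurable_funM => //.
  by apply: (measurableT_comp (@measurable_expR R)); exact: measurable_funM.
have sq w : `|psi w| <= b -> (lam * psi w) ^+ 2 <= (lam * b) ^+ 2.
  move=> h; rewrite !exprMn ler_wpM2l ?sqr_ge0// -(real_normK (num_real (psi w))).
  by rewrite ler_pXn2r// ?nnegrE// (le_trans _ h).
have iE : Pr.-integrable setT (EFin \o (fun w => W w * expR (lam * psi w))).
  apply: (ae_le_integrable mE (iZ (expR (`|lam| * b)))).
  apply: filterS psib => w h.
  rewrite ger0_norm ?mulr_ge0 ?expR_ge0// mulrC ler_wpM2r// ler_expR.
  by apply: le_trans (ler_norm _) _; rewrite normrM ler_wpM2l.
split=> //; pose bd w := lam * (W w * psi w) + expR (2 * (lam * b) ^+ 2) * W w.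
have ibd1 : Pr.-integrable setT (EFin \o (fun w => lam * (W w * psi w))).
  exact: (integrableZl measurableT lam iWpsi).
have ibd : Pr.-integrable setT (EFin \o bd).
  exact: (integrableD measurableT ibd1 (iZ _)).
apply: (@le_trans _ _ (\int[Pr]_w bd w)).
  apply: ae_le_Rintegral => //.
  apply: filterS psib => w h; rewrite /bd.
  have -> : lam * (W w * psi w) + expR (2 * (lam * b) ^+ 2) * W w =
    W w * (lam * psi w + expR (2 * (lam * b) ^+ 2)) by ring.
  apply: ler_wpM2l => //; apply: le_trans (expR_le_addr_expR_sqr _) _.
  by rewrite lerD2l ler_expR; have := sq w h; lra.
by rewrite /bd RintegralD// ?RintegralZl// ?Wpsi0 ?mulr0 ?add0r.
Qed.

Lemma subgaussian_tail (X : T -> R) (V s : R) :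
  measurable_fun setT X -> 0 < V -> 0 < s ->
  (forall lam, Pr.-integrable setT (EFin \o (fun w => expR (lam * X w))) /\
     \int[Pr]_w expR (lam * X w) <= expR (lam ^+ 2 * V)) ->
  (Pr [set w | (s < X w)%R] <= (expR (- (s ^+ 2 / (4 * V))))%:E)%E.
Proof.
move=> mX V0 s0 mgf.
(* The minimiser of the Chernoff exponent [lam ^+ 2 * V - lam * s]. *)
pose lam := s / (2 * V).
have lam0 : 0 < lam by rewrite divr_gt0// mulr_gt0.
have [iX le] := mgf lam.
have mge : measurable [set w | s <= X w].
  rewrite (_ : [set w | _] = X @^-1` `[s, +oo[%classic).
    by rewrite -[Z in measurable Z]setTI; apply: mX => //; exact: measurable_itv.
  by apply/seteqP; split => w /=; rewrite in_itv/= andbT.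
have mgt : measurable [set w | s < X w].
  rewrite (_ : [set w | _] = X @^-1` `]s, +oo[%classic).
    by rewrite -[Z in measurable Z]setTI; apply: mX => //; exact: measurable_itv.
  by apply/seteqP; split => w /=; rewrite in_itv/= andbT.
pose X' : {RV Pr >-> R} :=
  MeasurableFun.Pack (MeasurableFun.Class (isMeasurableFun.Build _ _ _ _ _ mX)).
apply: (@le_trans _ _ (Pr [set w | (s <= X w)%R])).
  by apply: le_measure; rewrite ?inE// => w /= /ltW.
apply: le_trans (chernoff X' s lam0) _.
have -> : ('M_Pr X' lam = (\int[Pr]_w expR (lam * X w))%:E)%E.
  rewrite /mmt_gen_fun unlock /Rintegral fineK; last first.
    exact: (integrable_fin_num measurableT iX).
  by apply: eq_integral => w _; rewrite /= mulrC.
rewrite -EFinM lee_fin.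
apply: (@le_trans _ _ (expR (lam ^+ 2 * V) * expR (- (lam * s)))).
  by rewrite ler_wpM2r ?expR_ge0.
rewrite -expRD ler_expR /lam le_eqVlt; apply/orP; left; apply/eqP.
by field; rewrite gt_eqF.
Qed.

(** A union bound over the [2 * n] one-sided coordinate events. Of the two factors [n.+1], one
    passes from coordinates to the norm and the other enlarges the exponent enough to pay for the
    union. *)
Lemma subgaussian_enorm (n : nat) (X : T -> 'rV[R]_n) (V U eta : R) :
  (forall j, measurable_fun setT (fun w => X w 0 j)) -> 0 < V ->
  (forall j lam,
     Pr.-integrable setT (EFin \o (fun w => expR (lam * X w 0 j))) /\
     \int[Pr]_w expR (lam * X w 0 j) <= expR (lam ^+ 2 * V)) ->
  0 < eta < 1 ->
  2 * n.+1%:R ^+ 2 * Num.sqrt V * Num.sqrt (ln (2 / eta)) <= U ->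
  measurable [set w | enorm (X w) <= U] /\
  ((1 - eta)%:E <= Pr [set w | (enorm (X w) <= U)%R])%E.
Proof.
move=> mX V0 mgf /andP[eta0 eta1] hU.
set E := [set w | _].
have mE : measurable E.
  rewrite (_ : E = (fun w => enorm (X w)) @^-1` `]-oo, U]%classic).
    rewrite -[Z in measurable Z]setTI; apply: measurable_enorm => //.
  by apply/seteqP; split => w /=; rewrite in_itv.
split => //.
set L := ln (2 / eta) in hU.
have L0 : 0 < L by rewrite ln_gt0// ltr_pdivlMr//; lra.
have n0 : 0 < n.+1%:R :> R by [].
pose s := U / n.+1%:R.
have s_ge : 2 * n.+1%:R * Num.sqrt V * Num.sqrt L <= s.
  rewrite ler_pdivlMr//; apply: le_trans hU.
  by rewrite le_eqVlt; apply/orP; left; apply/eqP; ring.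
have s0 : 0 < s.
  by apply: lt_le_trans s_ge; rewrite !mulr_gt0// sqrtr_gt0.
have exponent : n.+1%:R * L <= s ^+ 2 / (4 * V).
  rewrite ler_pdivlMr ?mulr_gt0//.
  have : (2 * n.+1%:R * Num.sqrt V * Num.sqrt L) ^+ 2 <= s ^+ 2.
    rewrite ler_pXn2r// nnegrE; last exact: ltW.
    by rewrite !mulr_ge0// sqrtr_ge0.
  have sV := sqr_sqrtr (ltW V0); have sL := sqr_sqrtr (ltW L0).
  have -> : (2 * n.+1%:R * Num.sqrt V * Num.sqrt L) ^+ 2 =
      n.+1%:R * L * (4 * V) * n.+1%:R.
    by rewrite -{2}sV -{2}sL; ring.
  move=> h; apply: le_trans h; apply: ler_peMr; last by rewrite ler1n.
  by rewrite mulr_ge0 ?mulr_ge0 ?(ltW L0) ?(ltW V0).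
(* The probability allowed to each one-sided event; the total [n%:R * (2 * eps)] is at most [eta]
   because [n] is below [2 ^ n]. *)
pose eps := (eta / 2) ^+ n.+1.
have epsE : expR (- (s ^+ 2 / (4 * V))) <= eps.
  apply: (@le_trans _ _ (expR (- (n.+1%:R * L)))).
    by rewrite ler_expR lerN2.
  by rewrite expRN expRM_natl lnK ?posrE ?divr_gt0// -exprVn invf_div.
have eps_le : n%:R * (2 * eps) <= eta.
  have -> : n%:R * (2 * eps) = eta * (eta ^+ n * (n%:R / 2 ^+ n)).
    by rewrite /eps exprS expr_div_n; field; rewrite expf_neq0.
  rewrite -[leRHS]mulr1; apply: ler_wpM2l; first exact: ltW.
  have e0 := ltW eta0; have e1 := ltW eta1.
  apply: mulr_ile1; rewrite ?exprn_ge0 ?divr_ge0 ?exprn_ile1//.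
  by rewrite ler_pdivrMr ?exprn_gt0// mul1r -natrX ler_nat ltnW// ltn_expl.
have mset (Y : T -> R) : measurable_fun setT Y -> measurable [set w | s < Y w].
  move=> mY; rewrite (_ : [set w | _] = Y @^-1` `]s, +oo[%classic).
    by rewrite -[Z in measurable Z]setTI; apply: mY => //; exact: measurable_itv.
  by apply/seteqP; split => w /=; rewrite in_itv/= andbT.
pose B (j : 'I_n) := [set w | s < X w 0 j] `|` [set w | s < - X w 0 j].
have mB j : measurable (B j).
  by apply: measurableU; apply: mset => //; exact: measurableT_comp.
have PB j : (Pr (B j) <= (2 * eps)%:E)%E.
  have -> : 2 * eps = eps + eps by ring.
  have mN : measurable_fun setT (fun w => - X w 0 j) by exact: measurableT_comp.
  apply: le_trans (measureU2 _ _ _) _; [exact: mset|exact: mset|].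
  rewrite EFinD; apply: leeD.
    apply: le_trans (subgaussian_tail (mX j) V0 s0 (mgf j)) _.
    by rewrite lee_fin.
  apply: le_trans (subgaussian_tail mN V0 s0 _) _; last by rewrite lee_fin.
  move=> lam; have := mgf j (- lam).
  rewrite sqrrN (_ : (fun w => expR (- lam * X w 0 j)) =
    fun w => expR (lam * - X w 0 j))//.
  by apply/funext => w; rewrite mulNr mulrN.
(* Boole's inequality is stated for sequences indexed by naturals; indices from [n] on get the empty
   set. *)
pose A (i : nat) := if insub i is Some j then B j else set0.
have mA i : (i < n)%N -> measurable (A i) by move=> _; rewrite /A; case: insub.
have cover : ~` E `<=` \big[setU/set0]_(i < n) A i.
  move=> w /= Ew; apply: contrapT => h; apply: Ew.
  rewrite /E /= (_ : U = n.+1%:R * s); last by rewrite mulrC divfK ?gt_eqF.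
  apply: enorm_le_coord; first exact: ltW.
  move=> j; rewrite leNgt; apply/negP => sj; apply: h.
  rewrite -bigcup_mkord; exists j => //=.
  by rewrite /A -[nat_of_ord j]/(val j) valK; move: sj; rewrite ltr_normr => /orP.
have PC : (Pr (~` E) <= eta%:E)%E.
  apply: (@le_trans _ _ (Pr (\big[setU/set0]_(i < n) A i))).
    apply: le_measure; rewrite ?inE//; first exact: measurableC.
    by apply: bigsetU_measurable => i _; exact: mA.
  apply: le_trans (@Boole_inequality _ _ _ Pr A n mA) _.
  apply: (@le_trans _ _ (\sum_(i < n) (2 * eps)%:E)%E).
    apply: lee_sum => i _; rewrite /A.
    by case: insubP => [j _ _|]; [exact: PB|rewrite ltn_ord].
  by rewrite sumEFin lee_fin sumr_const card_ord -[_ *+ n]mulr_natl.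
move: PC; rewrite probability_setC// lee_subel_addl ?fin_num_measure// => PC.
by rewrite EFinB leeBlDl// addeC.
Qed.

End SubGaussian.

(** * Adapted processes *)

Lemma coordB_le_enorm (R : realType) (n : nat) (u v : 'rV[R]_n) j :
  u 0 j - v 0 j <= enorm (u - v).
Proof. by apply: le_trans (norm_coord_le _ j); rewrite !mxE ler_norm. Qed.

Section Adapted.
Context (R : realType) (dO dX : measure_display) (Omega : measurableType dO)
  (Xi : measurableType dX) (Pr : probability Omega R) (P : probability Xi R)
  (m : nat) (xi : nat -> 'I_m -> {RV Pr >-> Xi}) (n : nat).
Implicit Types X Y : Omega -> 'rV[R]_n.

Lemma ae_has_law (Z : {RV Pr >-> Xi}) (Q : Xi -> Prop) :
  has_law P Z -> {ae P, forall z, Q z} -> {ae Pr, forall w, Q (Z w)}.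
Proof.
move=> lawZ [N [mN PN hN]]; exists (Z @^-1` N); split.
- by rewrite -[X in measurable X]setTI; exact: measurable_funP.
- by have := lawZ _ mN; rewrite /distribution /pushforward PN.
- by move=> w /= Qw; apply: hN.
Qed.

(** Integrating the conditional probability 1 over the whole space gives [Pr A = 1]. *)
Lemma is_cond_probability_one_ae (G : set (set Omega)) (A : set Omega) :
  G setT -> is_cond_probability Pr G A (cst 1) -> {ae Pr, forall w, A w}.
Proof.
move=> GT [iA _ _ /(_ _ GT)].
have mA : measurable A.
  by apply/(measurable_indicP R)/measurable_EFinP; exact: measurable_int iA.
move=> int1; have PA : Pr A = 1%E.
  transitivity (\int[Pr]_w (\1_A w)%:E)%E; first by rewrite integral_indic// setIT.
  rewrite int1; transitivity (\int[Pr]_w (cst 1 w : \bar R))%E; first by [].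
  by rewrite integral_cst// mul1e; exact: probability_setT.
exists (~` A); split => //; first exact: measurableC.
by rewrite probability_setC// PA subee.
Qed.

(* Sample gradients are measurable only up to null sets, so that adaptedness is
   required of an almost surely equal version. *)
Definition adapted (k : nat) X := exists2 X' : Omega -> 'rV[R]_n,
  (forall j, measurable_fun [set: filtered_space xi k]
    ((fun w => X' w 0 j) : filtered_space xi k -> R)) &
  {ae Pr, forall w, X w = X' w}.

Lemma adapted_cst k v : adapted k (fun=> v).
Proof. by exists (fun=> v) => // ; exact: aeW. Qed.

Lemma adapted_mono k k' X : (k <= k')%N -> adapted k X -> adapted k' X.
Proof.
by move=> kk' [X' mX' XX']; exists X' => // j; exact: measurable_filtered_mono (mX' j).
Qed.

Lemma adapted_ae_eq k X Y : {ae Pr, forall w, X w = Y w} -> adapted k Y -> adapted k X.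
Proof.
by move=> XY [Y' mY' YY']; exists Y' => //; apply: filterS2 XY YY' => w -> ->.
Qed.

Lemma adaptedD k X Y : adapted k X -> adapted k Y -> adapted k (fun w => X w + Y w).
Proof.
move=> [X' mX' XX'] [Y' mY' YY']; exists (fun w => X' w + Y' w).
  by move=> j; under eq_fun do rewrite mxE; exact: measurable_funD.
by apply: filterS2 XX' YY' => w -> ->.
Qed.

Lemma adaptedZ k a X : adapted k X -> adapted k (fun w => a *: X w).
Proof.
move=> [X' mX' XX']; exists (fun w => a *: X' w).
  by move=> j; under eq_fun do rewrite mxE; exact: measurable_funM.
by apply: filterS XX' => w ->.
Qed.

Lemma adaptedB k X Y : adapted k X -> adapted k Y -> adapted k (fun w => X w - Y w).
Proof.
move=> hX /(adaptedZ (-1)) /(adaptedD hX); apply: adapted_ae_eq.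
by apply: aeW => w /=; rewrite scaleN1r.
Qed.

Lemma adapted_sum k (I : Type) (s : seq I) (X : I -> Omega -> 'rV[R]_n) :
  (forall i, adapted k (X i)) -> adapted k (fun w => \sum_(i <- s) X i w).
Proof.
move=> hX; elim: s => [|i s IH].
  by apply: (adapted_ae_eq _ (adapted_cst k 0)); apply: aeW => w; rewrite big_nil.
apply: (adapted_ae_eq _ (adaptedD (hX i) IH)).
by apply: aeW => w; rewrite big_cons.
Qed.

Lemma adapted_lipschitz k K (H : 'rV[R]_n -> 'rV[R]_n) X : 0 < K ->
  (forall p q, enorm (H p - H q) <= K * enorm (p - q)) ->
  adapted k X -> adapted k (fun w => H (X w)).
Proof.
move=> K0 lipH [X' mX' XX']; exists (fun w => H (X' w)).
  move=> j; apply: (measurable_lipschitz_comp (H := fun q _ => H q 0 j) K0) => //.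
  by move=> _ p q; exact: le_trans (coordB_le_enorm _ _ j) (lipH p q).
by apply: filterS XX' => w ->.
Qed.

Lemma adapted_sample k t i K (G : 'rV[R]_n -> Xi -> 'rV[R]_n) X :
  (1 <= t < k)%N -> 0 < K ->
  (forall q j, measurable_fun setT (fun z => G q z 0 j)) ->
  (forall z p q, enorm (G p z - G q z) <= K * enorm (p - q)) ->
  adapted k X -> adapted k (fun w => G (X w) (xi t i w)).
Proof.
move=> tk K0 mG lipG [X' mX' XX']; exists (fun w => G (X' w) (xi t i w)).
  move=> j; pose H q (w : filtered_space xi k) := G q (xi t i w) 0 j.
  apply: (measurable_lipschitz_comp (H := H) K0) => //.
    move=> q; apply: (measurableT_comp (mG q j)); exact: measurable_filtered_sample.
  by move=> w p q; exact: le_trans (coordB_le_enorm _ _ j) (lipG _ p q).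
by apply: filterS XX' => w ->.
Qed.

Lemma adapted_expR k X j lam : adapted k X ->
  exists2 W : Omega -> R, measurable_fun [set: filtered_space xi k]
    (W : filtered_space xi k -> R) &
  {ae Pr, forall w, expR (lam * X w 0 j) = W w}.
Proof.
move=> [X' mX' XX']; exists (fun w => expR (lam * X' w 0 j)).
  apply: (measurableT_comp (@measurable_expR R)); exact: measurable_funM.
by apply: filterS XX' => w ->.
Qed.

(** With F_k-measurable versions of [W] and [X], the integrand depends on a pair: the identity into
    [filtered_space xi k], which carries all of the past, and the fresh sample. Independence of the
    two reduces the claim to a zero mean for each frozen past. *)
Lemma adapted_zero_mean k t i K (G : 'rV[R]_n -> Xi -> 'rV[R]_n)
    (g : 'rV[R]_n -> 'rV[R]_n) X (W W' Y : Omega -> R) j (s : R) :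
  iid_samples P xi -> (1 <= k)%N -> (k <= t)%N -> 0 < K ->
  (forall q j, measurable_fun setT (fun z => G q z 0 j)) ->
  (forall z p q, enorm (G p z - G q z) <= K * enorm (p - q)) ->
  (forall p q, enorm (g p - g q) <= K * enorm (p - q)) ->
  (forall q j, P.-integrable setT (EFin \o (fun z => G q z 0 j))) ->
  (forall q j, \int[P]_z (G q z 0 j) = g q 0 j) ->
  adapted k X ->
  measurable_fun [set: filtered_space xi k] (W' : filtered_space xi k -> R) ->
  {ae Pr, forall w, W w = W' w} -> Pr.-integrable setT (EFin \o W) ->
  measurable_fun setT Y ->
  {ae Pr, forall w, Y w = (G (X w) (xi t i w) - g (X w)) 0 j} ->
  {ae Pr, forall w, `|Y w| <= s} ->
  \int[Pr]_w (W w * Y w) = 0.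
Proof.
move=> iid k1 kt K0 mG lipG lipg iG intG [X' mX' XX'] mW' WW' iW mY YE Ys.
have mW : measurable_fun setT W by exact/measurable_EFinP/(measurable_int _ iW).
pose h (w : filtered_space xi k) z := W' w * (G (X' w) z 0 j - g (X' w) 0 j).
have mgX : measurable_fun [set: filtered_space xi k]
    ((fun w => g (X' w) 0 j) : filtered_space xi k -> R).
  apply: (measurable_lipschitz_comp (H := fun q _ => g q 0 j) K0) => //.
  by move=> _ p q; exact: le_trans (coordB_le_enorm _ _ j) (lipg p q).
have mh : measurable_fun setT
    (fun az : filtered_space xi k * Xi => h az.1 az.2).
  apply: measurable_funM.
    exact: (measurableT_comp (f := W' : filtered_space xi k -> R) mW' measurable_fst).
  apply: measurable_funB; last first.
    exact: (measurableT_comp (f := (fun w => g (X' w) 0 j) : filtered_space xi k -> R)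
      mgX measurable_fst).
  pose H q (az : filtered_space xi k * Xi) := G q az.2 0 j.
  apply: (measurable_lipschitz_comp (H := H) (X := fun az => X' az.1) K0).
  - by move=> q; apply: (measurableT_comp (mG q j)); exact: measurable_snd.
  - by move=> az p q; exact: le_trans (coordB_le_enorm _ _ j) (lipG az.2 p q).
  - move=> j'; exact: (measurableT_comp
      (f := (fun w => X' w 0 j') : filtered_space xi k -> R) (mX' j') measurable_fst).
have mid : measurable_fun setT (id : Omega -> filtered_space xi k).
  by move=> _ B mB; rewrite setTI;
    exact: (@filtration_measurable _ _ _ _ _ _ _ xi k B mB).
have mhO : measurable_fun setT (fun w : Omega => h w (xi t i w)).
  have mp : measurable_fun setT (fun w : Omega => (id w : filtered_space xi k, xi t i w)).
    exact: (measurable_fun_pair mid (measurable_funP (xi t i))).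
  exact: (measurableT_comp mh mp).
have hE : {ae Pr, forall w, W w * Y w = h w (xi t i w)}.
  by apply: filterS3 XX' WW' YE => w XE -> ->; rewrite /h !mxE XE.
rewrite (ae_eq_Rintegral _ mhO hE); last exact: measurable_funM.
have iB w : P.-integrable setT (EFin \o (fun z => G (X' w) z 0 j - g (X' w) 0 j)).
  exact: (integrableB measurableT (iG (X' w) j)
    (finite_measure_integrable_cst P (g (X' w) 0 j) measurableT)).
apply: (integral_independent_eq0 (A := id : Omega -> filtered_space xi k) (P := P)) => //.
- by case: iid => + _; apply; exact: leq_trans kt.
- by move=> B C mB mC; exact: (sample_independent i iid k1 kt mC mB).
- apply: (@ae_le_integrable _ _ _ _ _ (fun w => s * `|W w|)) => //.
    exact: (integrableZl measurableT s (integrable_norm iW)).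
  apply: filterS2 hE Ys => w <- h1.
  by rewrite normrM mulrC ler_wpM2r.
- move=> w; rewrite /h RintegralZl//.
    have ic := @finite_measure_integrable_cst _ _ _ P setT (g (X' w) 0 j) measurableT.
    rewrite RintegralB// intG Rintegral_cst// [Z in _ * fine Z]probability_setT.
    by rewrite mulr1 subrr mulr0.
- by move=> w; exact: (integrableZl measurableT (W' w) (iB w)).
Qed.

End Adapted.

(** * The S-PStorm error *)

Section Uncorrelated.
Context d (T : measurableType d) (R : realType) (mu : probability T R).
Variable W : T -> R.

(** The form in which a zero conditional mean is used: [Y] is tested only against the fixed weight
    [W]. Integrability is included so that the property is closed under sums. *)
Definition uncorrelated (Y : T -> R) :=
  mu.-integrable setT (EFin \o (fun w => W w * Y w)) /\
  \int[mu]_w (W w * Y w) = 0.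

Lemma uncorrelated0 : uncorrelated (fun=> 0).
Proof.
split; under eq_fun do rewrite mulr0.
  exact: (@finite_measure_integrable_cst _ _ _ mu setT 0 measurableT).
by rewrite Rintegral_cst// mul0r.
Qed.

Lemma uncorrelatedD Y Z : uncorrelated Y -> uncorrelated Z ->
  uncorrelated (fun w => Y w + Z w).
Proof.
move=> [iY Y0] [iZ Z0]; split; under eq_fun do rewrite mulrDr.
  exact: (integrableD measurableT iY iZ).
by rewrite RintegralD// Y0 Z0 addr0.
Qed.

Lemma uncorrelatedZ a Y : uncorrelated Y -> uncorrelated (fun w => a * Y w).
Proof.
move=> [iY Y0]; split; under eq_fun do rewrite mulrCA.
  exact: (integrableZl measurableT a iY).
by rewrite RintegralZl// Y0 mulr0.
Qed.

Lemma uncorrelated_sum (I : Type) (s : seq I) (Y : I -> T -> R) :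
  (forall i, uncorrelated (Y i)) -> uncorrelated (fun w => \sum_(i <- s) Y i w).
Proof.
move=> hY; elim: s => [|i s IH].
  by under eq_fun do rewrite big_nil; exact: uncorrelated0.
by under eq_fun do rewrite big_cons; exact: uncorrelatedD.
Qed.

End Uncorrelated.

(** The algebra of the S-PStorm update, with [p] and [q] the full gradients at the new and the
    previous iterate: adding and subtracting [b *: q] centres every sample gradient. *)
Lemma average_recursion (R : realType) (n m : nat) (a e : 'I_m -> 'rV[R]_n)
    (p q dv : 'rV[R]_n) (b : R) : (0 < m)%N ->
  m%:R^-1 *: (\sum_(i < m) a i) + b *: (dv - m%:R^-1 *: (\sum_(i < m) e i)) - p =
  b *: (dv - q) + m%:R^-1 *: \sum_(i < m) (a i - p - b *: (e i - q)).
Proof.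
move=> m0; rewrite !sumrB -scaler_sumr sumrB !sumr_const card_ord.
have m1 : m%:R != 0 :> R by rewrite pnatr_eq0 -lt0n.
move: (\sum_i a i) (\sum_i e i) => A E; apply/rowP => j.
by rewrite -(scaler_nat m p) -(scaler_nat m q) !mxE; field.
Qed.

Lemma ae_le_norm_average d (T : measurableType d) (R : realType)
    (mu : probability T R) (m : nat) (Y : 'I_m -> T -> R) (M : R) : (0 < m)%N ->
  (forall i, {ae mu, forall w, `|Y i w| <= M}) ->
  {ae mu, forall w, `|m%:R^-1 * \sum_(i < m) Y i w| <= M}.
Proof.
move=> m0 hY.
have : {ae mu, forall w, `|\sum_(i < m) Y i w| <= \sum_(i < m) M}.
  elim: (index_enum _) => [|i s IH]; first by apply: aeW => w; rewrite !big_nil normr0.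
  apply: filterS2 IH (hY i) => w h1 h2; rewrite !big_cons.
  by apply: le_trans (ler_normD _ _) _; exact: lerD.
have m1 : 0 < m%:R :> R by rewrite ltr0n.
apply: filterS => w; rewrite sumr_const card_ord -[M *+ m]mulr_natl => h.
by rewrite normrM normfV (gtr0_norm m1) ler_pdivrMl.
Qed.

(** * Error recursion of the algorithm and its moment generating function *)

Section Storm.
Context (R : realType)
    (dO dX : measure_display) (Omega : measurableType dO)
    (Xi : measurableType dX) (Pr : probability Omega R) (P : probability Xi R)
    (n : nat) (l : 'rV[R]_n -> Xi -> R)
    (N : nat) (g : 'I_N -> {set 'I_n})
    (r_ : forall i : 'I_N, 'rV[R]_#|g i| -> R)
    (m : nat) (xi : nat -> 'I_m -> {RV Pr >-> Xi})
    (x1 : 'rV[R]_n) (beta alpha : nat -> R) (zeta : R)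
    (x v u d y : nat -> Omega -> 'rV[R]_n)
    (mu_f Lg Gr sigma Gd c alpha_ : R).
Context (HS : S_PStorm P l xi (group_sum r_) x1 beta alpha zeta x v u d y)
  (HA : assumption_A P l r_ mu_f Lg)
  (HB : assumption_B P l xi (group_sum r_) x d Gr sigma Gd)
  (HC : assumption_C c alpha_ beta alpha).
(** [G] stands for the everywhere Lipschitz and measurable version of the sample gradient built in
    [gradient_expected_loss]. *)
Context (G : 'rV[R]_n -> Xi -> 'rV[R]_n).

Let gl (q : 'rV[R]_n) (z : Xi) : 'rV[R]_n := gradient (l ^~ z) q.
Let gf : 'rV[R]_n -> 'rV[R]_n := gradient (expected_loss P l).
Let r := group_sum r_.

Context (G_gl : {ae P, forall z, forall q, G q z = gl q z})
  (G_lip : forall z p q, enorm (G p z - G q z) <= Lg * enorm (p - q))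
  (G_meas : forall q j, measurable_fun setT (fun z => G q z 0 j))
  (G_int : forall q j, P.-integrable setT (EFin \o (fun z => G q z 0 j)))
  (G_mean : forall q j, \int[P]_z (G q z 0 j) = gf q 0 j).

Let Lg0 : 0 < Lg := A_Lg_gt0 HA.
Let K0 : 0 < n.+1%:R * Lg. Proof. by rewrite mulr_gt0. Qed.
Let L_le_K e : Lg * enorm (e : 'rV[R]_n) <= n.+1%:R * Lg * enorm e.
Proof.
rewrite ler_wpM2r ?enorm_ge0// ler_peMl ?(ltW Lg0)//.
by rewrite ler1n.
Qed.

Lemma gradient_coord_lipschitz p q j : `|gf p 0 j - gf q 0 j| <= Lg * enorm (p - q).
Proof.
rewrite -!G_mean -RintegralB//; apply: ae_le_norm_Rintegral.
  exact: measurable_funB.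
apply: aeW => z /=; apply: le_trans (G_lip z p q).
by apply: le_trans (norm_coord_le _ j); rewrite !mxE.
Qed.

(** The constant is obtained coordinate by coordinate, which costs [n.+1]; the bound serves
    measurability arguments, where its size is immaterial. *)
Lemma gradient_lipschitz p q : enorm (gf p - gf q) <= n.+1%:R * Lg * enorm (p - q).
Proof.
rewrite -mulrA; apply: enorm_le_coord.
  by rewrite mulr_ge0 ?enorm_ge0// ltW.
move=> j; rewrite [Z in `|Z|]mxE [Z in _ + Z]mxE.
exact: gradient_coord_lipschitz.
Qed.

Lemma sample_law t i : (1 <= t)%N -> has_law P (xi t i).
Proof. by case: (storm_samples HS) => + _; apply. Qed.

Lemma sample_indep k t i : (1 <= k)%N -> (k <= t)%N ->
  independent_of (xi t i) (filtration xi k).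
Proof. exact: sample_independent (storm_samples HS). Qed.

(** Measurability is read off the integrability contained in the unbiasedness assumption, which
    applies to any sample drawn at iteration [k] or later. *)
Lemma measurable_storm_grad k t i j : (1 <= k)%N -> (k <= t)%N ->
  measurable_fun setT (fun w => gl (x k w) (xi t i w) 0 j).
Proof.
move=> k1 kt; have t1 := leq_trans k1 kt.
have [iX _ _ _] := B_unbiased HB k1 (sample_law i t1) (sample_indep i k1 kt) j.
exact/measurable_EFinP/(measurable_int _ iX).
Qed.

Let i0 : 'I_m := Ordinal (storm_batch HS).

Lemma measurable_full_grad k j : (1 <= k)%N ->
  measurable_fun setT (fun w => gf (x k w) 0 j).
Proof.
move=> k1.
have [_ iX _ _] := B_unbiased HB k1 (sample_law i0 k1) (sample_indep i0 k1 (leqnn k)) j.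
exact/measurable_EFinP/(measurable_int _ iX).
Qed.

Lemma measurable_direction k j : (1 <= k)%N -> measurable_fun setT (fun w => d k w 0 j).
Proof.
have mv k' j' : (1 <= k')%N -> measurable_fun setT (fun w => v k' w 0 j').
  move=> k1; under eq_fun do rewrite (storm_v HS)// mxE summxE.
  apply: measurable_funM => //; apply: measurable_sum => i.
  exact: measurable_storm_grad.
elim: k => // -[_ _|k IH _].
  by under eq_fun do rewrite (storm_d1 HS); exact: mv.
under eq_fun do rewrite (storm_d HS)// (storm_u HS)// !mxE summxE.
apply: measurable_funD; first exact: mv.
apply: measurable_funM => //; apply: measurable_funB; first exact: IH.
apply: measurable_funM => //; apply: measurable_sum => i.
exact: measurable_storm_grad.
Qed.

Let filtrationT k : filtration xi k setT.
Proof. exact: (@measurableT _ (filtered_space xi k)). Qed.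

(** The noise at iterate [k] of a sample from iteration [t]; [t = k] and [t = k.+1] both occur,
    since each batch is also evaluated at the previous iterate. *)
Let D k t i w := gl (x k w) (xi t i w) - gf (x k w).
Let eps k w := d k w - gf (x k w).

Lemma noise_le k t i : (1 <= k)%N -> (k <= t)%N ->
  {ae Pr, forall w, enorm (D k t i w) <= sigma}.
Proof.
move=> k1 kt; have t1 := leq_trans k1 kt.
exact: (is_cond_probability_one_ae (@filtrationT k)
  (B_variance HB k1 (sample_law i t1) (sample_indep i k1 kt))).
Qed.

Lemma direction_le k : (1 <= k)%N -> {ae Pr, forall w, enorm (d k w) <= Gd}.
Proof.
by move=> k1; exact: (is_cond_probability_one_ae (@filtrationT k) (B_direction HB k1)).
Qed.

Let beta01 k : (1 <= k)%N -> 0 < beta k < 1. Proof. exact: storm_beta HS k. Qed.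

Let r_convex : convex_fun r. Proof. exact: group_sum_convex (A_r_convex HA). Qed.

Lemma step_le k : (1 <= k)%N -> {ae Pr, forall w,
  enorm (x k.+1 w - x k w) <= zeta * beta k * (alpha_ * (Gd + Gr))}.
Proof.
move=> k1; apply: filterS2 (direction_le k1) (B_subgradients HB k1) => w dw sw.
have [s hs] := subdifferential_neq0 (x k w) r_convex.
have z0 := storm_zeta HS; have [b0 _] := andP (beta01 k1).
rewrite (storm_x HS)// addrC addKr enormZ.
have zb : 0 <= zeta * beta k by apply: mulr_ge0; exact: ltW.
rewrite (ger0_norm zb); apply: ler_wpM2l => //.
rewrite (storm_y HS)// (C_alpha HC)//.
apply: le_trans (prox_step_le r_convex (C_alpha_gt0 HC) _ hs) _.
by rewrite ler_wpM2l ?(ltW (C_alpha_gt0 HC))// lerD// sw.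
Qed.

Lemma adapted_storm_grad k t i X : (1 <= t < k)%N ->
  adapted xi k X -> adapted xi k (fun w => gl (X w) (xi t i w)).
Proof.
move=> tk aX; have [t1 _] := andP tk.
apply: (adapted_ae_eq _ (adapted_sample i tk Lg0 G_meas G_lip aX)).
by have := ae_has_law (sample_law i t1) G_gl; apply: filterS => w ->.
Qed.

(** The two claims need a joint induction: [x k.+1] is built from [d k], and [d k.+1] from [x k.+1],
    [d k] and the new batch. Hence [d] is adapted one index later than [x]. *)
Lemma adapted_iterate k : adapted xi k.+1 (x k.+1) /\ adapted xi k.+2 (d k.+1).
Proof.
have ad_v k' : adapted xi k'.+2 (x k'.+1) -> adapted xi k'.+2 (v k'.+1).
  move=> ax; have vE : {ae Pr, forall w, v k'.+1 w =
      m%:R^-1 *: \sum_(i < m) gl (x k'.+1 w) (xi k'.+1 i w)}.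
    by apply: aeW => w; rewrite (storm_v HS).
  apply: (adapted_ae_eq vE); apply: adaptedZ; apply: adapted_sum => i.
  by apply: adapted_storm_grad; rewrite //= ltnS.
elim: k => [|k [ax ad]].
  have ax : adapted xi 1 (x 1).
    apply: (adapted_ae_eq _ (adapted_cst _ _ x1)).
    by apply: aeW => w; rewrite (storm_x1 HS).
  split => //; apply: (@adapted_ae_eq _ _ _ _ _ _ _ _ _ _ _ (v 1)).
    by apply: aeW => w; rewrite (storm_d1 HS).
  by apply: ad_v; apply: adapted_mono ax.
have ax1 : adapted xi k.+2 (x k.+1) by apply: adapted_mono ax.
have ax2 : adapted xi k.+2 (x k.+2).
  have xE : {ae Pr, forall w, x k.+2 w = x k.+1 w + (zeta * beta k.+1) *:
      (prox alpha_ r (x k.+1 w - alpha_ *: d k.+1 w) - x k.+1 w)}.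
    apply: aeW => w; rewrite (storm_x HS w (isT : (1 <= k.+1)%N)).
    by rewrite (storm_y HS w (isT : (1 <= k.+1)%N)) (C_alpha HC (isT : (1 <= k.+1)%N)).
  apply: (adapted_ae_eq xE); apply: adaptedD => //; apply: adaptedZ.
  apply: adaptedB => //; apply: (adapted_lipschitz (K := 1)) => //.
    by move=> p q; rewrite mul1r; exact: (prox_nonexpansive r_convex (C_alpha_gt0 HC)).
  by apply: adaptedB => //; exact: adaptedZ.
split => //.
have ax3 : adapted xi k.+3 (x k.+2) by apply: adapted_mono ax2.
have dE : {ae Pr, forall w, d k.+2 w = v k.+2 w + (1 - beta k.+2) *:
    (d k.+1 w - m%:R^-1 *: \sum_(i < m) gl (x k.+1 w) (xi k.+2 i w))}.
  apply: aeW => w; rewrite (storm_d HS w (isT : (2 <= k.+2)%N)).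
  by rewrite (storm_u HS w (isT : (2 <= k.+2)%N)).
apply: (adapted_ae_eq dE); apply: adaptedD; first exact: ad_v.
apply: adaptedZ; apply: adaptedB; first exact: adapted_mono ad.
apply: adaptedZ; apply: adapted_sum => i.
by apply: adapted_storm_grad; rewrite //= ?ltnS//; exact: adapted_mono ax1.
Qed.

Lemma adapted_error k : adapted xi k.+2 (eps k.+1).
Proof.
have [ax ad] := adapted_iterate k; apply: adaptedB => //.
apply: (adapted_lipschitz K0 gradient_lipschitz).
exact: adapted_mono ax.
Qed.

Lemma measurable_error k j : (1 <= k)%N -> measurable_fun setT (fun w => eps k w 0 j).
Proof.
move=> k1.
have -> : (fun w => eps k w 0 j) = (fun w => d k w 0 j - gf (x k w) 0 j).
  by apply/funext => w; rewrite [LHS]mxE [Z in _ + Z]mxE.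
by apply: measurable_funB; [exact: measurable_direction|exact: measurable_full_grad].
Qed.

Lemma measurable_noise k t i j : (1 <= k)%N -> (k <= t)%N ->
  measurable_fun setT (fun w => D k t i w 0 j).
Proof.
move=> k1 kt.
have -> : (fun w => D k t i w 0 j) =
    (fun w => gl (x k w) (xi t i w) 0 j - gf (x k w) 0 j).
  by apply/funext => w; rewrite [LHS]mxE [X in _ + X]mxE.
by apply: measurable_funB; [exact: measurable_storm_grad|exact: measurable_full_grad].
Qed.

(** The iterate index [s] may be smaller than the conditioning index [k], which covers a fresh
    sample evaluated at the previous iterate. *)
Lemma noise_uncorrelated k t s i j (W W' : Omega -> R) :
  (1 <= s)%N -> (s <= k)%N -> (k <= t)%N ->
  measurable_fun [set: filtered_space xi k] (W' : filtered_space xi k -> R) ->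
  {ae Pr, forall w, W w = W' w} -> Pr.-integrable setT (EFin \o W) ->
  uncorrelated Pr W (fun w => D s t i w 0 j).
Proof.
move=> s1 sk kt mW' WW' iW; have st := leq_trans sk kt; have t1 := leq_trans s1 st.
have mW : measurable_fun setT W by exact/measurable_EFinP/(measurable_int _ iW).
have mD := measurable_noise i j s1 st.
have Dle : {ae Pr, forall w, `|D s t i w 0 j| <= sigma}.
  by apply: filterS (noise_le i s1 st) => w; apply: le_trans (norm_coord_le _ j).
split.
  apply: (@ae_le_integrable _ _ _ _ _ (fun w => sigma * `|W w|)).
  - exact: measurable_funM.
  - exact: (integrableZl measurableT sigma (integrable_norm iW)).
  - by apply: filterS Dle => w h; rewrite normrM mulrC ler_wpM2r.
have axs : adapted xi k (x s).
  by case: s s1 sk {st mD Dle} => // s _ sk; apply: adapted_mono sk (adapted_iterate s).1.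
have GE : {ae Pr, forall w, D s t i w = G (x s w) (xi t i w) - gf (x s w)}.
  by have := ae_has_law (sample_law i t1) G_gl; apply: filterS => w ->.
apply: (adapted_zero_mean (K := n.+1%:R * Lg) (s := sigma) (W' := W') (k := k)
  (t := t) (i := i) (G := G) (g := gf) (X := x s) (j := j) (P := P)) => //.
- exact: storm_samples HS.
- exact: leq_trans sk.
- by move=> z p q; apply: le_trans (G_lip z p q) _.
- exact: gradient_lipschitz.
- exact: axs.
- exact: mW'.
- by have := GE; apply: filterS => w ->.
Qed.

(** The innovation of iteration [k.+1]: it enters [eps k.+1] and is built from the samples of that
    iteration. *)
Let psi k w : 'rV[R]_n := m%:R^-1 *: \sum_(i < m)
  (D k.+1 k.+1 i w - (1 - beta k.+1) *: D k k.+1 i w).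

Lemma error_recursion k w : (1 <= k)%N ->
  eps k.+1 w = (1 - beta k.+1) *: eps k w + psi k w.
Proof.
move=> k1; rewrite /eps (storm_d HS)// (storm_v HS)// (storm_u HS)//.
exact: (average_recursion (fun i => gl (x k.+1 w) (xi k.+1 i w))
  (fun i => gl (x k w) (xi k.+1 i w)) _ _ _ _ (storm_batch HS)).
Qed.

Lemma error_first w : eps 1 w = m%:R^-1 *: \sum_(i < m) D 1 1 i w.
Proof.
rewrite /eps (storm_d1 HS) (storm_v HS)//.
(* The recursion with factor 0 degenerates to the centring of a plain average. *)
have := average_recursion (fun i => gl (x 1 w) (xi 1%N i w))
  (fun i => gl (x 1 w) (xi 1%N i w)) (gf (x 1 w)) 0 0 0 (storm_batch HS).
rewrite !scale0r addr0 add0r => ->.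
by congr (_ *: _); apply: eq_bigr => i _; rewrite scale0r subr0.
Qed.

Let psiE k w j : psi k w 0 j = m%:R^-1 * \sum_(i < m)
  (D k.+1 k.+1 i w 0 j + - (1 - beta k.+1) * D k k.+1 i w 0 j).
Proof.
rewrite mxE summxE; congr (_ * _); apply: eq_bigr => i _.
by rewrite [LHS]mxE [Z in _ + Z]mxE [Z in - Z]mxE mulNr.
Qed.

Let eps1E w j : eps 1 w 0 j = m%:R^-1 * \sum_(i < m) D 1 1 i w 0 j.
Proof. by rewrite error_first [LHS]mxE summxE. Qed.

(** The constant B of the almost sure bound. The factor 4 is 2, for sample and full gradient
    increments, times 2 from [beta_le_double]. *)
Definition noise_scale := sigma + 4 * Lg * zeta * alpha_ * (Gr + Gd).

Lemma noise_scale_gt0 : 0 < noise_scale.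
Proof.
have s0 := B_sigma_gt0 HB; have r0 := B_Gr_gt0 HB; have d0 := B_Gd_gt0 HB.
have z0 := storm_zeta HS; have a0 := C_alpha_gt0 HC.
by rewrite addr_gt0// !mulr_gt0// addr_gt0.
Qed.

Lemma sigma_le_noise_scale : sigma <= noise_scale.
Proof.
have r0 := B_Gr_gt0 HB; have d0 := B_Gd_gt0 HB.
have z0 := storm_zeta HS; have a0 := C_alpha_gt0 HC.
by rewrite lerDl ltW// !mulr_gt0// addr_gt0.
Qed.

(** Steps have length of order [beta k], while the innovation is to be measured in [beta k.+1]; the
    ratio is controlled because [k + 2] is at most [2 * (k + 1)]. *)
Lemma beta_le_double k : (1 <= k)%N -> beta k <= 2 * beta k.+1.
Proof.
move=> k1; rewrite !(C_beta HC)//; have c1 := C_c_gt1 HC.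
have k0 : 1 <= k%:R :> R by rewrite ler1n.
rewrite -[k.+2%:R]natr1 -[k.+1%:R]natr1.
have [h|h] := leP (1 / 2) (c / (k%:R + 1 + 1)).
  by rewrite ge_min; apply/orP; left; lra.
rewrite ge_min; apply/orP; right.
rewrite ler_pdivrMr; last by lra.
have -> : 2 * (c / (k%:R + 1 + 1)) * (k%:R + 1) = c * (2 * (k%:R + 1)) / (k%:R + 1 + 1).
  by field; lra.
rewrite ler_pdivlMr; last by lra.
rewrite ler_wpM2l; lra.
Qed.

Lemma innovation_le k j : (1 <= k)%N ->
  {ae Pr, forall w, `|psi k w 0 j| <= noise_scale * beta k.+1}.
Proof.
move=> k1; have [b0 b1] := andP (@beta01 k.+1 isT).
suff hi i : {ae Pr, forall w,
    `|D k.+1 k.+1 i w 0 j + - (1 - beta k.+1) * D k k.+1 i w 0 j| <=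
    noise_scale * beta k.+1}.
  apply: filterS (ae_le_norm_average (storm_batch HS) hi) => w.
  by rewrite psiE.
have Glip : {ae Pr, forall w,
    `|gl (x k.+1 w) (xi k.+1 i w) 0 j - gl (x k w) (xi k.+1 i w) 0 j| <=
    Lg * enorm (x k.+1 w - x k w)}.
  have := ae_has_law (@sample_law k.+1 i isT) G_gl; apply: filterS => w GE.
  rewrite -!GE; apply: le_trans (G_lip _ _ _); apply: le_trans (norm_coord_le _ j).
  by rewrite !mxE.
apply: filterS3 Glip (step_le k1) (noise_le i (isT : (1 <= k.+1)%N) (leqnn k.+1)) => w.
have DE t s' : D t s' i w 0 j = gl (x t w) (xi s' i w) 0 j - gf (x t w) 0 j.
  by rewrite [LHS]mxE [Z in _ + Z]mxE.
move=> h1 h2 /(le_trans (norm_coord_le _ j)) h3.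
have h4 := gradient_coord_lipschitz (x k.+1 w) (x k w) j.
(* Fresh noise with weight [beta k.+1], plus a difference of gradient increments that the last step
   length controls. *)
have -> : D k.+1 k.+1 i w 0 j + - (1 - beta k.+1) * D k k.+1 i w 0 j =
    beta k.+1 * D k.+1 k.+1 i w 0 j + (1 - beta k.+1) *
    ((gl (x k.+1 w) (xi k.+1 i w) 0 j - gl (x k w) (xi k.+1 i w) 0 j) -
     (gf (x k.+1 w) 0 j - gf (x k w) 0 j)).
  by rewrite !DE; ring.
move: h1 h3 h4; set p1 := _ - gl _ _ _ _; set p2 := D _ _ _ _ _ _.
set p3 := _ - gf _ _ _; set e := enorm _ in h2 *; move=> h1 h3 h4.
apply: le_trans (ler_normD _ _) _; rewrite !normrM (gtr0_norm b0).
have b2 : 0 <= 1 - beta k.+1 by lra.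
have h5 : `|p1 - p3| <= 2 * Lg * e by apply: le_trans (ler_normB _ _) _; lra.
have h6 : `|1 - beta k.+1| * `|p1 - p3| <= 2 * Lg * e.
  rewrite (ger0_norm b2) -[leRHS]mul1r; apply: ler_pM => //; lra.
have h7 : 2 * Lg * e <= 2 * Lg * (zeta * (2 * beta k.+1) * (alpha_ * (Gd + Gr))).
  have z0 := storm_zeta HS; have a0 := C_alpha_gt0 HC.
  have r0 := B_Gr_gt0 HB; have d0 := B_Gd_gt0 HB.
  apply: ler_wpM2l; first by rewrite mulr_ge0// ltW.
  apply: le_trans h2 _; apply: ler_wpM2r; first by rewrite mulr_ge0 ?addr_ge0// ltW.
  by apply: ler_wpM2l; [exact: ltW|exact: beta_le_double].
have h8 : beta k.+1 * `|p2| <= beta k.+1 * sigma by rewrite ler_wpM2l// ltW.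
rewrite /noise_scale; lra.
Qed.

(** Induction on [k] for all [lam] at once, because the step invokes the hypothesis at
    [lam * (1 - beta k.+2)]. *)
Lemma error_mgf (K : R) j :
  2 * noise_scale ^+ 2 * (c ^+ 2 / (c - 1) + 2 * c + 3) <= K ->
  forall k lam, (1 <= k)%N ->
  Pr.-integrable setT (EFin \o (fun w => expR (lam * eps k w 0 j))) /\
  \int[Pr]_w expR (lam * eps k w 0 j) <= expR (lam ^+ 2 * (K / k.+2%:R)).
Proof.
move=> hK; have c1 := C_c_gt1 HC; have B0 := noise_scale_gt0.
have cc : 0 <= c ^+ 2 / (c - 1) by rewrite divr_ge0 ?sqr_ge0//; lra.
have B2 : 0 <= 2 * noise_scale ^+ 2 by rewrite mulr_ge0 ?sqr_ge0.
have hK1 : 2 * noise_scale ^+ 2 * (c ^+ 2 / (c - 1) + 2 * c) <= K.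
  by apply: le_trans hK; rewrite ler_wpM2l//; lra.
(* The summand 3 is for the base case, where the variance proxy is [K / 3]. *)
have hK2 : 2 * noise_scale ^+ 2 * 3 <= K.
  by apply: le_trans hK; rewrite ler_wpM2l//; lra.
elim=> // -[_ lam _|k IH lam _].
  (* The first error is a pure innovation, treated with the constant weight 1. *)
  have iW : Pr.-integrable setT (EFin \o (fun=> 1 : R)).
    exact: (finite_measure_integrable_cst Pr 1 measurableT).
  have [_ unc] : uncorrelated Pr (fun=> 1) (fun w => eps 1 w 0 j).
    rewrite (_ : (fun w => eps 1 w 0 j) =
      fun w => m%:R^-1 * \sum_(i < m) D 1 1 i w 0 j); last first.
      by apply/funext => w; rewrite eps1E.
    apply: uncorrelatedZ; apply: uncorrelated_sum => i.
    by apply: (@noise_uncorrelated 1 1 1 i j (fun=> 1) (fun=> 1)) => //; exact: aeW.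
  have le1 : {ae Pr, forall w, `|eps 1 w 0 j| <= noise_scale}.
    have hi i : {ae Pr, forall w, `|D 1 1 i w 0 j| <= noise_scale}.
      apply: filterS (noise_le i (leqnn 1) (leqnn 1)) => w h.
      apply: le_trans (norm_coord_le _ j) _; apply: le_trans h _.
      exact: sigma_le_noise_scale.
    by apply: filterS (ae_le_norm_average (storm_batch HS) hi) => w; rewrite eps1E.
  have [] := subgaussian_step lam (measurable_error j (leqnn 1))
    (fun=> ler01) iW le1 unc.
  rewrite (_ : (fun w => 1 * expR (lam * eps 1 w 0 j)) =
    fun w => expR (lam * eps 1 w 0 j)); last by apply/funext => w; rewrite mul1r.
  move=> i1 le2; split => //; apply: le_trans le2 _.
  rewrite Rintegral_cst// [Z in _ * (_ * fine Z)]probability_setT !mulr1 ler_expR.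
  rewrite exprMn mulrCA ler_wpM2l ?sqr_ge0// ler_pdivlMr//; lra.
pose b := beta k.+2; have hb := C_beta HC (isT : (1 <= k.+2)%N).
(* The exponential of the contracted previous error; multiplied by [expR (lam * psi k.+1 w 0 j)] it
   gives that of [eps k.+2]. *)
pose W w := expR (lam * (1 - b) * eps k.+1 w 0 j).
have [iW leW] := IH (lam * (1 - b)) isT; rewrite -/W in iW leW.
have [W' mW' WW'] := adapted_expR j (lam * (1 - b)) (adapted_error k).
have coordE w : eps k.+2 w 0 j = (1 - b) * eps k.+1 w 0 j + psi k.+1 w 0 j.
  by rewrite error_recursion// [LHS]mxE [Z in Z + _]mxE.
have mpsi : measurable_fun setT (fun w => psi k.+1 w 0 j).
  rewrite (_ : (fun w => psi k.+1 w 0 j) = (fun w => eps k.+2 w 0 j -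
    (1 - b) * eps k.+1 w 0 j)); last first.
    by apply/funext => w; rewrite coordE addrC addKr.
  apply: measurable_funB; first exact: measurable_error.
  by apply: measurable_funM => //; exact: measurable_error.
have [_ unc] : uncorrelated Pr W (fun w => psi k.+1 w 0 j).
  rewrite (_ : (fun w => psi k.+1 w 0 j) = fun w => m%:R^-1 * \sum_(i < m)
    (D k.+2 k.+2 i w 0 j + - (1 - b) * D k.+1 k.+2 i w 0 j)); last first.
    by apply/funext => w; rewrite psiE.
  apply: uncorrelatedZ; apply: uncorrelated_sum => i; apply: uncorrelatedD.
    exact: (@noise_uncorrelated k.+2 k.+2 k.+2 i j W W').
  apply: uncorrelatedZ.
  exact: (@noise_uncorrelated k.+2 k.+2 k.+1 i j W W').
have [] := subgaussian_step lam mpsi (fun w => expR_ge0 _) iW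
  (innovation_le j (isT : (1 <= k.+1)%N)) unc.
rewrite (_ : (fun w => W w * expR (lam * psi k.+1 w 0 j)) =
    fun w => expR (lam * eps k.+2 w 0 j)); last first.
  by apply/funext => w; rewrite -expRD coordE; congr expR; ring.
move=> i1 le2; split => //; apply: le_trans le2 _.
apply: le_trans (ler_wpM2l (expR_ge0 _) leW) _; rewrite -expRD ler_expR -/b.
have := step_size_recursion c1 B2 hK1 (isT : (1 <= k.+2)%N) hb; rewrite -/b => h.
rewrite [leLHS](_ : _ = lam ^+ 2 *
  ((1 - b) ^+ 2 * (K / k.+3%:R) + 2 * noise_scale ^+ 2 * b ^+ 2)); last by ring.
by rewrite ler_wpM2l ?sqr_ge0.
Qed.

End Storm.

(** * Choice of the constant and conclusion *)

Theorem theorem3p4 (R : realType)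
    (dO dX : measure_display) (Omega : measurableType dO)
    (Xi : measurableType dX) (Pr : probability Omega R) (P : probability Xi R)
    (n : nat) (l : 'rV[R]_n -> Xi -> R)
    (N : nat) (g : 'I_N -> {set 'I_n})
    (r_ : forall i : 'I_N, 'rV[R]_#|g i| -> R)
    (m : nat) (xi : nat -> 'I_m -> {RV Pr >-> Xi})
    (x1 : 'rV[R]_n) (beta alpha : nat -> R) (zeta : R)
    (x v u d y : nat -> Omega -> 'rV[R]_n)
    (mu_f Lg Gr sigma Gd c alpha_ : R) :
  smooth_convex_loss P l ->
  is_indexed_partition g ->
  S_PStorm P l xi (group_sum r_) x1 beta alpha zeta x v u d y ->
  assumption_A P l r_ mu_f Lg ->
  assumption_B P l xi (group_sum r_) x d Gr sigma Gd ->
  assumption_C c alpha_ beta alpha ->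
  let eps k w := d k w - gradient (expected_loss P l) (x k w) in
  let kbar : int := Num.ceil (2 * c - 1) in
  exists C : R, 0 < C /\
    forall (k : nat) (eta : R), kbar <= k%:Z -> 0 < eta < 1 ->
      let U := C * (sigma + Lg * (Gr + Gd) * zeta * alpha_) *
        Num.max (((kbar + 1)%:~R / (k + 2)%:R) `^ c)
                (c / Num.sqrt (k + 2)%:R) *
        Num.sqrt (ln (2 / eta)) in
      let E := [set w | enorm (eps k w) <= U] in
      measurable E /\ ((1 - eta)%:E <= Pr E)%E.
Proof.
move=> HL Hpart HS HA HB HC eps kbar.
have [G [G_gl G_lip G_meas G_int G_mean]] :=
  gradient_expected_loss HL (A_Lg_gt0 HA) (A_lipschitz HA).
have c1 := C_c_gt1 HC; have Lg0 := A_Lg_gt0 HA.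
have sig0 := B_sigma_gt0 HB; have r0 := B_Gr_gt0 HB; have d0 := B_Gd_gt0 HB.
have z0 := storm_zeta HS; have a0 := C_alpha_gt0 HC.
pose B := noise_scale zeta Lg Gr sigma Gd alpha_.
have B0 : 0 < B := noise_scale_gt0 HS HA HB HC.
have cc : 0 <= c ^+ 2 / (c - 1) by rewrite divr_ge0 ?sqr_ge0//; lra.
pose K := 2 * B ^+ 2 * (c ^+ 2 / (c - 1) + 2 * c + 3).
have K0 : 0 < K by rewrite !mulr_gt0//; lra.
pose S := sigma + Lg * (Gr + Gd) * zeta * alpha_.
have S0 : 0 < S by rewrite addr_gt0// !mulr_gt0// addr_gt0.
(* With this constant, [C * S * (c / Num.sqrt k.+2%:R)] is exactly the factor [2 * n.+1%:R ^+ 2 *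
   Num.sqrt (K / k.+2%:R)] that [subgaussian_enorm] asks for; neither [k] nor [eta] enters. *)
exists (2 * n.+1%:R ^+ 2 * Num.sqrt K / (S * c)); split.
  by rewrite divr_gt0 ?mulr_gt0 ?sqrtr_gt0 ?exprn_gt0//; lra.
move=> k eta hk heta U E.
(* As [c > 1], the threshold [2 * c - 1] is positive, which excludes [k = 0]. *)
have k1 : (1 <= k)%N.
  have h1 : 2 * c - 1 <= kbar%:~R by exact: Num.Theory.ceil_ge.
  have h2 : (kbar%:~R : R) <= (k%:Z)%:~R by rewrite ler_int.
  have := le_trans h1 h2; case: k {hk U E h2} => //; rewrite mulr0z; lra.
have k20 : 0 < k.+2%:R :> R by [].
apply: (@subgaussian_enorm _ _ _ Pr n (eps k) (K / k.+2%:R) U eta) => //.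
- by move=> j; exact: (measurable_error HS HB j k1).
- by rewrite divr_gt0.
- move=> j lam.
  exact: (error_mgf HS HA HB HC G_gl G_lip G_meas G_int G_mean j (lexx K) lam k1).
rewrite /U -/S addn2 sqrtrM ?(ltW K0)// sqrtrV ?(ltW k20)//.
rewrite ler_wpM2r ?sqrtr_ge0//.
set M := Num.max _ _.
have hM : c / Num.sqrt k.+2%:R <= M by rewrite le_max lexx orbT.
have C0 : 0 <= 2 * n.+1%:R ^+ 2 * Num.sqrt K / (S * c) * S.
  by rewrite mulr_ge0 ?(ltW S0)// divr_ge0 ?mulr_ge0 ?sqrtr_ge0 ?exprn_ge0//; lra.
apply: le_trans (ler_wpM2l C0 hM).
have s0 : 0 < Num.sqrt k.+2%:R :> R by rewrite sqrtr_gt0.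
rewrite le_eqVlt; apply/orP; left; apply/eqP.
by field; rewrite !gt_eqF//; lra.
Qed.
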